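(* Let $\tau>0$ be the time step, and let $\{u_{H,1}^n\}_{n=0}^{N_T}\subset V_{H,1}$ and $\{u_{H,2}^n\}_{n=0}^{N_T}\subset V_{H,2}$, with $u_H^n:=u_{H,1}^n+u_{H,2}^n$, satisfy for all $1\le n\le N_T-1$ the partially explicit scheme $$b\left(u_H^{n+1}-2u_H^n+u_H^{n-1},w\right)+\frac{\tau^2}{2}\,a\left(u_{H,1}^{n+1}+u_{H,1}^{n-1}+2u_{H,2}^n,w\right)=0\quad\forall w\in V_{H,1},$$ $$b\left(u_H^{n+1}-2u_H^n+u_H^{n-1},w\right)+\tau^2 a\left(u_{H,1}^n+u_{H,2}^n,w\right)=0\quad\forall w\in V_{H,2}.$$ If $$\|v_2\|_b^2\ \ge\ \frac{\tau^2}{2}\|v_2\|_a^2\qquad\forall v_2\in V_{H,2},$$ then the scheme is stable in the sense that, for all $n$ with $1\le n\le N_T-1$, $$\|u_{H,1}^{n}\|_a^2+\|u_{H,2}^{n+1}\|_a^2+\|u_{H,2}^{n}\|_a^2+\|u_{H,1}^{n+1}\|_a^2\ \le\ \frac{2}{\tau^2(1-\gamma_a)}\,E^{\frac12},$$ where $$\gamma_a=\sup_{u_1\in V_{H,1}\setminus\{0\},\,u_2\in V_{H,2}\setminus\{0\}}\frac{a(u_1,u_2)}{\|u_1\|_a\|u_2\|_a}<1$$ and $E^{\frac12}$ is the value at $n=0$ of the discrete energy $$E^{n+\frac12}=\|u_H^{n+1}-u_H^n\|_b^2+\frac{\tau^2}{2}\sum_{i=1,2}\left(\|u_{H,i}^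{n+1}\|_a^2+\|u_{H,i}^n\|_a^2\right)+\tau^2a(u_{H,2}^{n+1},u_{H,1}^n)+\tau^2a(u_{H,1}^{n+1},u_{H,2}^n)-\frac{\tau^2}{2}\|u_{H,2}^{n+1}-u_{H,2}^n\|_a^2.$$
   Context: Domain, grids and forms. $\Omega\subset\mathbb{R}^d$ is a bounded domain and $\kappa$ is a coefficient with $0<\kappa_0\le\kappa(x)\le\kappa_1$ on $\Omega$. $\mathcal{T}^H$ is a partition of $\Omega$ into disjoint coarse elements $K_1,\dots,K_N$, and $\mathcal{T}^h$ is a fine partition refining it. $V_h$ is the conforming bilinear finite element space on $\mathcal{T}^h$ with zero values on $\partial\Omega$, and $V(K_i)$ is the conforming bilinear finite element space on the fine grid within $K_i$. $(\cdot,\cdot)$ is the $L^2(\Omega)$ inner product, $a(u,v)=\int_\Omega\kappa\nabla u\cdot\nabla v$, and $\|u\|_a=a(u,u)^{1/2}$. Auxiliary spaces. Fix a constant $\kappa_{\text{cutoff}}$. Each $K_i$ is split into $K_1^{(i)}=\{x\in K_i:\kappa(x)\le\kappa_{\text{cutoff}}\}$ and $K_2^{(i)}=\{x\in K_i:\kappa(x)>\kappa_{\text{cutoff}}\}$. The functions $\psi_j^{(i)}$, $1\le j\le l_i$ with $l_i\in\{1,2\}$, are the characteristic functions of the nonempty regions among these, normalized in $L^2$. Let $\tilde V$ be the set of functions $v$ with $(v,\psi_j^{(i)})=0$ for all $i,j$. In each $K_i$ one solves the eigenvalue problem: find $\xi_j^{(i)}\in V(K_i)\cap\tilde V$ and $\gamma_j^{(i)}\in\mathbb{R}$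 with $\int_{K_i}\kappa\nabla\xi_j^{(i)}\cdot\nabla v=\gamma_j^{(i)}\int_{K_i}\xi_j^{(i)}v$ for all $v\in V(K_i)\cap\tilde V$. The eigenvalues are ordered increasingly, the eigenfunctions are $L^2$-orthonormal and extended by zero outside $K_i$, and the first $L_i$ eigenfunctions are kept. Set $V_{\text{aux},1}=\mathrm{span}\{\psi_j^{(i)}:1\le i\le N,1\le j\le l_i\}$ and $V_{\text{aux},2}=\mathrm{span}\{\xi_j^{(i)}:1\le i\le N,1\le j\le L_i\}$. The families $\{\psi_j^{(i)}\}$ and $\{\xi_j^{(i)}\}$ are each $L^2(\Omega)$-orthonormal. Define $\pi=\pi_1+\pi_2$ with $\pi_1(v)=\sum_{i,j}(v,\psi_j^{(i)})\psi_j^{(i)}$ and $\pi_2(v)=\sum_{i,j}(v,\xi_j^{(i)})\xi_j^{(i)}$. The mass-lumped form is $b(v,w)=(\pi(v),\pi(w))$, with $\|v\|_b^2=b(v,v)$. Multiscale spaces. For an integer $m\ge1$, $K_{i,m}$ is the oversampling domain obtained by enlarging $K_i$ by $m$ layers of coarse elements, and $V(K_{i,m})$ is the space of functions of $V_h$ supported in $K_{i,m}$. The basis function $\phi_{j,1}^{(i)}\in V(K_{i,m})$, together with a multiplier $\mu_{j,1}^{(i)}\in V_{\text{aux},1}\oplus V_{\text{aux},2}$, solves $a(\phi_{j,1}^{(i)},v)+(\mu_{j,1}^{(i)},v)=0$ for all $v\in V(K_{i,m})$, $(\phi_{j,1}^{(i)}-\psi_j^{(i)},\chi_1)=0$ for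 all $\chi_1\in V_{\text{aux},1}$, and $(\phi_{j,1}^{(i)},\chi_2)=0$ for all $\chi_2\in V_{\text{aux},2}$. The basis function $\phi_{j,2}^{(i)}\in V(K_{i,m})$, together with $\mu_{j,2}^{(i)}\in V_{\text{aux},1}\oplus V_{\text{aux},2}$, solves $a(\phi_{j,2}^{(i)},v)+(\mu_{j,2}^{(i)},v)=0$ for all $v\in V(K_{i,m})$, $(\phi_{j,2}^{(i)},\chi_1)=0$ for all $\chi_1\in V_{\text{aux},1}$, and $(\phi_{j,2}^{(i)}-\xi_j^{(i)},\chi_2)=0$ for all $\chi_2\in V_{\text{aux},2}$. These problems are assumed solvable. Then $V_{H,1}=\mathrm{span}\{\phi_{j,1}^{(i)}:1\le i\le N,1\le j\le l_i\}$ and $V_{H,2}=\mathrm{span}\{\phi_{j,2}^{(i)}:1\le i\le N,1\le j\le L_i\}$. *)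

(* Defs.v *)
From HB Require Import structures.
From mathcomp Require Import all_boot all_order all_algebra.
From mathcomp Require Import all_classical all_reals all_analysis.
Set Implicit Arguments. Unset Strict Implicit. Unset Printing Implicit Defensive.
Import Order.TTheory GRing.Theory Num.Theory numFieldNormedType.Exports.
Local Open Scope classical_set_scope.
Local Open Scope ring_scope.

Section tuple_measure_succ.
Context d (T : measurableType d) (R : realType) (n : nat).
Variable m : {measure set (n.-tuple T) -> \bar R}.
Variable m1 : {sigma_finite_measure set T -> \bar R}.

Let cons_pair (p : n.-tuple T * T) : n.+1.-tuple T := [tuple of p.2 :: p.1].

Let measurable_cons_pair : measurable_fun setT cons_pair.
Proof. exact: measurable_cons. Qed.

Definition tuple_measure_succ : set (n.+1.-tuple T) -> \bar R :=
  pushforward (m \x m1)%E cons_pair.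

Let succ0 : tuple_measure_succ set0 = 0%E.
Proof. by rewrite /tuple_measure_succ; exact: measure0. Qed.

Let succ_ge0 A : (0 <= tuple_measure_succ A)%E.
Proof. by rewrite /tuple_measure_succ; exact: measure_ge0. Qed.

Let succ_additive : semi_sigma_additive tuple_measure_succ.
Proof. by rewrite /tuple_measure_succ; exact: measure_semi_sigma_additive. Qed.

HB.instance Definition _ := isMeasure.Build _ _ _ tuple_measure_succ
  succ0 succ_ge0 succ_additive.

End tuple_measure_succ.

(* The new coordinate is the second factor of the product because [\x] requires
   its second factor, but not the first one, to be sigma-finite. *)
Fixpoint lebesgue_tuple (R : realType) (n : nat) :
    {measure set (n.-tuple (measurableTypeR R)) -> \bar R} :=
  if n is k.+1 then tuple_measure_succ (lebesgue_tuple R k) lebesgue_measure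
  else dirac [tuple].

Section euclidean_space.
Variables (R : realType) (n : nat).

Definition row_of_tuple (t : n.-tuple (measurableTypeR R)) : 'rV[R]_n :=
  \row_i tnth t i.

(* The Borel sigma-algebra of R^n, transported from the product sigma-algebra
   on n-tuples along the bijection [row_of_tuple]. *)
Let rV_measurable : set (set 'rV[R]_n) :=
  [set A | measurable (row_of_tuple @^-1` A)].

Let rV_measurable0 : rV_measurable set0.
Proof. exact: measurable0. Qed.

Let rV_measurableC A : rV_measurable A -> rV_measurable (~` A).
Proof. exact: measurableC. Qed.

Let rV_measurable_bigcup (F : (set 'rV[R]_n)^nat) :
  (forall i, rV_measurable (F i)) -> rV_measurable (\bigcup_i F i).
Proof.
by move=> mF; rewrite /rV_measurable/= preimage_bigcup; exact: bigcupT_measurable.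
Qed.

HB.instance Definition _ := @isMeasurable.Build default_measure_display
  'rV[R]_n rV_measurable rV_measurable0 rV_measurableC rV_measurable_bigcup.

Lemma measurable_row_of_tuple : measurable_fun setT row_of_tuple.
Proof. by move=> _ A mA; rewrite setTI. Qed.

Definition lebesgue_rV : set 'rV[R]_n -> \bar R :=
  pushforward (lebesgue_tuple R n) row_of_tuple.

Let lebesgue_rV0 : lebesgue_rV set0 = 0%E.
Proof. exact: (measure0 (lebesgue_tuple R n)). Qed.

Let lebesgue_rV_ge0 A : (0 <= lebesgue_rV A)%E.
Proof. exact: (measure_ge0 (lebesgue_tuple R n)). Qed.

Let lebesgue_rV_additive : semi_sigma_additive lebesgue_rV.
Proof.
move=> F mF tF mUF; rewrite /lebesgue_rV /pushforward preimage_bigcup.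
apply: measure_semi_sigma_additive; first exact: mF.
- apply/trivIsetP => /= i j _ _ ij; rewrite -preimage_setI.
  by move/trivIsetP : tF => /(_ _ _ _ _ ij) ->//; rewrite preimage_set0.
- by rewrite -preimage_bigcup; exact: mUF.
Qed.

HB.instance Definition _ := isMeasure.Build _ _ _ lebesgue_rV
  lebesgue_rV0 lebesgue_rV_ge0 lebesgue_rV_additive.

End euclidean_space.

Section forms.
Variables (R : realType) (d : nat).
Local Notation E := 'rV[R]_d.
Implicit Types (D : set E) (u v : E -> R).

Definition inner_on D u v : R := \int[@lebesgue_rV R d]_(x in D) (u x * v x).

(* [derive] is total: on the faces of the fine cells, where piecewise
   multilinear functions need not be differentiable, its value is immaterial
   because the faces are Lebesgue-negligible. *)
Definition energy_on (kappa : E -> R) D u v : R :=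
  \int[@lebesgue_rV R d]_(x in D)
    (kappa x * \sum_(i < d) 'D_(delta_mx 0 i) u x * 'D_(delta_mx 0 i) v x).

Definition multilinear_on D u : Prop :=
  exists c : {set 'I_d} -> R, forall x, D x ->
    u x = \sum_(S : {set 'I_d}) c S * \prod_(i in S) x 0 i.

Definition fspan (I : finType) (f : I -> E -> R) : set (E -> R) :=
  [set v | exists c : I -> R, v = \sum_i c i *: f i].

Definition closed_box (l h : E) : set E :=
  [set x | forall i, l 0 i <= x 0 i <= h 0 i].

Definition open_box (l h : E) : set E :=
  [set x | forall i, l 0 i < x 0 i < h 0 i].

(* Fine elements are axis-parallel boxes, the elements on which conforming
   multilinear (for d = 2, bilinear) functions live; hanging nodes are not
   excluded. Coarse elements are arbitrary unions of fine ones, so the coarse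
   partition is given by the map [parent] from fine to coarse elements. *)
Record mesh := Mesh {
  dom : set E;
  nfine : nat;
  ncoarse : nat;
  lo : 'I_nfine -> E;
  hi : 'I_nfine -> E;
  parent : 'I_nfine -> 'I_ncoarse;
  dom_open : open dom;
  dom_connected : connected dom;
  dom_bounded : bounded_set dom;
  dom_neq0 : dom !=set0;
  lo_lt_hi : forall k i, lo k 0 i < hi k 0 i;
  cells_disjoint : forall k l, k != l ->
    open_box (lo k) (hi k) `&` open_box (lo l) (hi l) = set0;
  cells_in_dom : forall k, open_box (lo k) (hi k) `<=` dom;
  cells_cover : \bigcup_k closed_box (lo k) (hi k) = closure dom;
  parent_surj : forall i, exists k, parent k = i }.

End forms.

Section spaces.
Variables (R : realType) (d : nat) (T : mesh R d).
Local Notation E := 'rV[R]_d.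
Local Notation N := (ncoarse T).

Definition cell (k : 'I_(nfine T)) : set E := closed_box (lo k) (hi k).

Definition coarse_closure (i : 'I_N) : set E :=
  \bigcup_(k in [set k | parent k = i]) cell k.

(* The [coarse i] cover the domain; they overlap only on element faces, a
   null set. *)
Definition coarse (i : 'I_N) : set E := dom T `&` coarse_closure i.

(* A layer consists of the coarse elements whose closure meets the current
   region, be it in a single point. *)
Fixpoint oversample (m : nat) (i : 'I_N) : set E :=
  if m is p.+1 then
    \bigcup_(j in [set j | coarse_closure j `&` oversample p i !=set0])
      coarse_closure j
  else coarse_closure i.

(* Finite element functions are total functions on R^d that vanish outside
   their domain: this encodes the zero boundary values of [fe_space] and the
   extension by zero of the (unconstrained) functions of [fe_local]. *)
Definition fe_space : set (E -> R) :=
  [set u | [/\ {within closure (dom T), continuous u},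
               forall k, multilinear_on (cell k) u &
               forall x, ~ dom T x -> u x = 0]].

Definition fe_local (i : 'I_N) : set (E -> R) :=
  [set u | [/\ {within coarse_closure i, continuous u},
               forall k, parent k = i -> multilinear_on (cell k) u &
               forall x, ~ coarse_closure i x -> u x = 0]].

Definition fe_oversample (m : nat) (i : 'I_N) : set (E -> R) :=
  fe_space `&` [set u | forall x, ~ oversample m i x -> u x = 0].

Definition inner (u v : E -> R) : R := inner_on (dom T) u v.

Definition proj (I : finType) (f : I -> E -> R) (v : E -> R) : E -> R :=
  \sum_i inner v (f i) *: f i.

Section multiscale.
Variables (kappa : E -> R) (kcut : R).

Definition energy (u v : E -> R) : R := energy_on kappa (dom T) u v.
Definition norm_a (v : E -> R) : R := Num.sqrt (energy v v).

Definition region (i : 'I_N) (high : bool) : set E :=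
  [set x | coarse i x /\ if high then kcut < kappa x else kappa x <= kcut].

(* Regions are taken modulo null sets: a region counts as nonempty when it has
   positive measure, as its normalization in L^2 requires. *)
Definition aux1_index : finType :=
  {p : 'I_N * bool | (0 < lebesgue_rV (region p.1 p.2))%E}.

Definition psi (p : aux1_index) : E -> R :=
  let A := region (val p).1 (val p).2 in
  fun x => \1_A x / Num.sqrt (fine (lebesgue_rV A)).

Definition Vtilde : set (E -> R) := [set v | forall p, inner v (psi p) = 0].

(* All the eigenpairs of the local problem, listed with multiplicity: [n] is the
   dimension of the local space, and [xi j], [gamma j] are irrelevant for
   [n <= j]. *)
Definition local_eigenbasis (i : 'I_N) (n : nat)
    (xi : nat -> E -> R) (gamma : nat -> R) : Prop :=
  let V := fe_local i `&` Vtilde in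
  [/\ forall j, (j < n)%N -> V (xi j),
      forall j, (j < n)%N -> forall v, V v ->
        energy_on kappa (coarse i) (xi j) v
        = gamma j * inner_on (coarse i) (xi j) v,
      forall j k, (j < n)%N -> (k < n)%N ->
        inner (xi j) (xi k) = (j == k)%:R,
      forall j k, (j <= k < n)%N -> gamma j <= gamma k &
      forall v, V v -> fspan (fun j : 'I_n => xi j) v].

Section aux2.
Variables (L : 'I_N -> nat) (xi : 'I_N -> nat -> E -> R).

Definition aux2_index : finType := {i : 'I_N & 'I_(L i)}.
Definition kept (q : aux2_index) : E -> R := xi (tag q) (tagged q).

Definition Vaux1 : set (E -> R) := fspan psi.
Definition Vaux2 : set (E -> R) := fspan kept.
Definition Vaux : set (E -> R) :=
  [set mu | exists chi1, exists2 chi2,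
     Vaux1 chi1 /\ Vaux2 chi2 & mu = chi1 + chi2].

Definition pi_aux (v : E -> R) : E -> R := proj psi v + proj kept v.
Definition lumped (v w : E -> R) : R := inner (pi_aux v) (pi_aux w).
Definition norm_b (v : E -> R) : R := Num.sqrt (lumped v v).

Definition basis1 (m : nat) (p : aux1_index) (phi mu : E -> R) : Prop :=
  [/\ fe_oversample m (val p).1 phi,
      Vaux mu,
      forall v, fe_oversample m (val p).1 v -> energy phi v + inner mu v = 0,
      forall chi1, Vaux1 chi1 -> inner (phi - psi p) chi1 = 0 &
      forall chi2, Vaux2 chi2 -> inner phi chi2 = 0].

Definition basis2 (m : nat) (q : aux2_index) (phi mu : E -> R) : Prop :=
  [/\ fe_oversample m (tag q) phi,
      Vaux mu,
      forall v, fe_oversample m (tag q) v -> energy phi v + inner mu v = 0,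
      forall chi1, Vaux1 chi1 -> inner phi chi1 = 0 &
      forall chi2, Vaux2 chi2 -> inner (phi - kept q) chi2 = 0].

Definition discrete_energy (tau : R) (u1 u2 : nat -> E -> R) (n : nat) : R :=
  let uH k := u1 k + u2 k in
  norm_b (uH n.+1 - uH n) ^+ 2
  + tau ^+ 2 / 2 * ((norm_a (u1 n.+1) ^+ 2 + norm_a (u1 n) ^+ 2)
                    + (norm_a (u2 n.+1) ^+ 2 + norm_a (u2 n) ^+ 2))
  + tau ^+ 2 * energy (u2 n.+1) (u1 n)
  + tau ^+ 2 * energy (u1 n.+1) (u2 n)
  - tau ^+ 2 / 2 * norm_a (u2 n.+1 - u2 n) ^+ 2.

End aux2.

(* When [V1] or [V2] is the zero space, the supremum is over the empty set and
   has the value 0. *)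
Definition gamma_a (V1 V2 : set (E -> R)) : R :=
  sup [set r | exists u1 u2, [/\ V1 u1, u1 != 0, V2 u2, u2 != 0 &
                                r = energy u1 u2 / (norm_a u1 * norm_a u2)]].

End multiscale.
End spaces.

(* Main.v *)
Require Import Defs.
From HB Require Import structures.
From mathcomp Require Import all_boot all_order all_algebra.
From mathcomp Require Import all_classical all_reals all_analysis.
From mathcomp Require Import measurable_realfun ring lra.
Set Implicit Arguments. Unset Strict Implicit. Unset Printing Implicit Defensive.
Import Order.TTheory GRing.Theory Num.Theory numFieldNormedType.Exports.
Local Open Scope classical_set_scope.
Local Open Scope ring_scope.

(** The discrete energy is a conserved quantity of the scheme, and under the
    stability condition it dominates the energy norms of both components.

    Conservation ([scheme_energy_conserved]) is algebra: test the first equation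
    with the difference of [u1] at the times [n+1] and [n-1], the second one with
    that of [u2], and add. The second difference in [b] telescopes, and the
    remaining terms are the increment of the energy.

    The lower bound ([scheme_energy_lower_bound]) has two ingredients. First, the
    spaces spanned by [phi1] and [phi2] are orthogonal for [b]
    ([lumped_orthogonal]): the projection sends them to the spans of the
    characteristic functions and of the eigenfunctions, which are orthogonal in
    L2. So the [b]-norm of an increment is at least that of its second component,
    and the stability condition lets it absorb the only negative square in the
    energy. Second, the mixed terms are bounded below by [- gamma_a] times
    products of norms, which leaves the factor [1 - gamma_a] in front of the sum
    of squares ([cosine_lower_bound]).

    That [gamma_a < 1] is a compactness statement ([quadratic_domination],
    [angle_gap], [sup_cosines_lt1]): on the finite-dimensional space of
    coefficients the quadratic form [a (v1 - v2) (v1 - v2)] is positive definite,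
    so it dominates a multiple of [a v1 v1 + a v2 v2]. Definiteness requires that
    the two families be jointly independent ([multiscale_independent]), which
    holds because the basis functions are dual to the auxiliary functions, and
    that a finite element function of zero energy vanish ([energy_eq0]).

    What precedes these steps makes [a] and [b] symmetric bilinear forms on the
    finite element space. Finite element functions, their total derivatives and
    the auxiliary functions agree off the faces of the cells, hence almost
    everywhere, with bounded measurable functions; the class [tame] captures
    this. *)

(** * Integrals off a null set *)

Section integral_off_null_set.
Context d (T : measurableType d) (R : realType).
Variable mu : {measure set T -> \bar R}.
Variables (N : set T) (mN : measurable N) (N0 : mu N = 0%E).
Import HBNNSimple.

(** The integral of a nonnegative function is the supremum of the integrals of
    the measurable simple functions below it, and cutting such a simple function
    off on [N] does not change its integral. This covers nonmeasurable
    integrands, which arise because the total derivative of a piecewise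
    multilinear function has arbitrary values on the faces of the cells. *)
Lemma ge0_le_integral_off_null (f g : T -> \bar R) :
  (forall x, 0 <= f x)%E -> (forall x, 0 <= g x)%E ->
  (forall x, ~ N x -> f x = g x) ->
  (\int[mu]_x f x <= \int[mu]_x g x)%E.
Proof.
move=> f0 g0 fg; rewrite !ge0_integralTE//.
apply: ge_ereal_sup => _ [h /= hf <-].
apply: le_ereal_sup_tmp.
exists (sintegral mu (proj_nnsfun h (measurableC mN))).
  exists (proj_nnsfun h (measurableC mN)) => // x /=.
  rewrite mindicE; case: (boolP (_ \in _)) => [|_]; last by rewrite mulr0.
  by rewrite inE mulr1 => /fg <-.
rewrite -!integralT_nnsfun le_eqVlt; apply/orP; left; apply/eqP.
apply: ge0_ae_eq_integral => //=.
- by apply/measurable_EFinP; exact: measurable_funPT.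
- by apply/measurable_EFinP; apply: measurable_funM; exact: measurable_funPT.
all: try by move=> x _; rewrite lee_fin ?mulr_ge0//; exact: fun_ge0.
exists N; split => // x /= /not_implyP[_] hx; apply: contrapT => Nx; apply: hx.
by rewrite mindicE mem_set// mulr1.
Qed.

Lemma eq_integral_off_null (D : set T) (f g : T -> \bar R) :
  (forall x, D x -> ~ N x -> f x = g x) ->
  (\int[mu]_(x in D) f x = \int[mu]_(x in D) g x)%E.
Proof.
move=> fg; rewrite integral_mkcond [RHS]integral_mkcond.
have {}fg x : ~ N x -> (f \_ D) x = (g \_ D) x.
  by move=> Nx; rewrite /patch; case: ifPn => //; rewrite inE => Dx; rewrite fg.
rewrite integralE [RHS]integralE; congr (_ - _)%E; apply/eqP; rewrite eq_le;
  apply/andP; split; apply: ge0_le_integral_off_null => x //.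
all: by move=> Nx; rewrite !(funeposE, funenegE) fg.
Qed.

Lemma eq_Rintegral_off_null (D : set T) (f g : T -> R) :
  (forall x, D x -> ~ N x -> f x = g x) ->
  \int[mu]_(x in D) f x = \int[mu]_(x in D) g x.
Proof.
by move=> fg; congr fine; apply: eq_integral_off_null => x Dx Nx; rewrite fg.
Qed.

End integral_off_null_set.

(** * Lebesgue measure of boxes in R^n *)

Section box_measure.
Variable R : realType.

Lemma measurable_tuple_box n (A : 'I_n -> set (measurableTypeR R)) :
  (forall i, measurable (A i)) ->
  measurable [set t : n.-tuple (measurableTypeR R) | forall i, A i (tnth t i)].
Proof.
move=> mA.
rewrite (_ : mkset _ = \bigcap_(i in [set: 'I_n]) ((@tnth n _)^~ i @^-1` A i)).
  apply: fin_bigcap_measurable => // i _.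
  rewrite -[X in measurable X]setTI.
  exact: (measurable_tnth i).
by apply/seteqP; split => t /= H i; [move=> _|]; exact: H.
Qed.

(** Each step of the recursive construction adds the head of the tuple as the
    second factor of a product measure, which splits off one side of the box. *)
Lemma lebesgue_tuple_box n (A : 'I_n -> set (measurableTypeR R)) :
  (forall i, measurable (A i)) ->
  lebesgue_tuple R n [set t | forall i, A i (tnth t i)] =
  (\big[mule/1]_(i < n) lebesgue_measure (A i))%E.
Proof.
elim: n A => [|n IH] A mA.
  rewrite big_ord0 /= diracE mem_set// => i; by case: i.
rewrite big_ord_recl muleC -IH; last by move=> i; exact: mA.
rewrite /= /tuple_measure_succ /pushforward /=.
rewrite -product_measure1E; last exact: mA; last first.
  by apply: (@measurable_tuple_box _ (fun i => A (lift ord0 i))) => i; exact: mA.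
congr product_measure1; apply/seteqP; split => -[t x] /=.
  by move=> H; split => [i|]; [have := H (lift ord0 i)|have := H ord0];
    rewrite !(tnth_nth point) /=.
move=> [H1 H2] i; case: (unliftP ord0 i) => [j|] ->.
  by have := H1 j; rewrite !(tnth_nth point).
by rewrite !(tnth_nth point).
Qed.
End box_measure.

Section lebesgue_rV_theory.
Variables (R : realType) (n : nat).
Local Notation E := 'rV[R]_n.
Local Notation mu := (@lebesgue_rV R n).

Lemma measurable_rV_box (A : 'I_n -> set R) : (forall i, measurable (A i)) ->
  measurable [set x : E | forall i, A i (x 0 i)].
Proof.
move=> mA; have := @measurable_tuple_box R n A mA.
congr measurable; apply/seteqP; split => t /= H i; have := H i; by rewrite mxE.
Qed.

Lemma lebesgue_rV_box (A : 'I_n -> set R) : (forall i, measurable (A i)) ->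
  mu [set x : E | forall i, A i (x 0 i)] =
  (\prod_(i < n) lebesgue_measure (A i))%E.
Proof.
move=> mA; rewrite -(@lebesgue_tuple_box R n A mA) /= /lebesgue_rV /pushforward.
congr (lebesgue_tuple R n _).
by apply/seteqP; split => t /= H i; have := H i; rewrite mxE.
Qed.

Lemma measurable_coord (i : 'I_n) : measurable_fun setT (fun x : E => x 0 i).
Proof.
move=> _ B mB; rewrite setTI.
have := @measurable_rV_box (fun j => if j == i then B else setT).
rewrite (_ : mkset _ = (fun x : E => x 0 i) @^-1` B); last first.
  apply/seteqP; split => x /= H; first by have := H i; rewrite eqxx.
  by move=> j; case: eqP => // ->.
by apply => j; case: ifP.
Qed.

(** An open set is the union of the boxes with rational corners that it
    contains, and there are countably many of these. *)
Lemma open_measurable_rV (U : set E) : open U -> measurable U.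
Proof.
move=> oU.
pose rbox (p : 'rV[rat]_n * 'rV[rat]_n) : set E :=
  [set x | forall i, ratr (p.1 0 i) < x 0 i < ratr (p.2 0 i)].
rewrite (_ : U = \bigcup_p [set x | rbox p `<=` U /\ rbox p x]); last first.
  apply/seteqP; split => x; last by move=> [p _ /= [sub xp]]; exact: sub.
  move=> Ux; have := open_nbhs_nbhs (conj oU Ux).
  rewrite -nbhs_ballE => -[e /= e0 be].
  have /choice[l hl] i : exists q : rat, x 0 i - e < ratr q < x 0 i.
    have /rat_in_itvoo[q] : x 0 i - e < x 0 i by rewrite ltrBlDr ltrDl.
    by rewrite in_itv /=; exists q.
  have /choice[h hh] i : exists q : rat, x 0 i < ratr q < x 0 i + e.
    have /rat_in_itvoo[q] : x 0 i < x 0 i + e by rewrite ltrDl.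
    by rewrite in_itv /=; exists q.
  exists (\row_i l i, \row_i h i) => //=; split => [y /= H|i]; last first.
    by rewrite !mxE; have /andP[_ ->] := hl i; have /andP[->] := hh i.
  apply: be; split => // i j; rewrite ord1 /ball /=.
  have := H j; rewrite !mxE => /andP[yl yh]; rewrite ltr_norml.
  have /andP[xl _] := hl j; have /andP[_ xh] := hh j.
  apply/andP; split.
    by move: xh yh; set a := ratr _; lra.
  by move: xl yl; set a := ratr _; lra.
apply: countable_bigcupT_measurable => // p.
have [sub|nsub] := pselect (rbox p `<=` U); last first.
  rewrite (_ : mkset _ = set0); first exact: measurable0.
  by apply/seteqP; split => x // [].
rewrite (_ : mkset _ = rbox p); last by apply/seteqP; split => x // [].
apply: (@measurable_rV_box (fun i => `]ratr (p.1 0 i), ratr (p.2 0 i)[%classic)).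
by move=> i; exact: measurable_itv.
Qed.

Lemma measurable_hyperplane (i : 'I_n) (c : R) : measurable [set x : E | x 0 i = c].
Proof.
by rewrite -[mkset _]setTI; apply: (measurable_coord i measurableT (measurable_set1 c)).
Qed.

Lemma lebesgue_rV_hyperplane (i : 'I_n) (c : R) : mu [set x : E | x 0 i = c] = 0%E.
Proof.
have := @lebesgue_rV_box (fun j => if j == i then [set c] else setT).
rewrite (_ : mkset _ = [set x : E | x 0 i = c]); last first.
  apply/seteqP; split => x /= H; first by have := H i; rewrite eqxx.
  by move=> j; case: eqP => // ->.
move=> -> => [|j]; last by case: ifP.
by rewrite (bigD1 i)//= eqxx lebesgue_measure_set1 mul0e.
Qed.

Lemma measurable_open_box (l h : E) : measurable (open_box l h).
Proof.
apply: (@measurable_rV_box (fun i => `]l 0 i, h 0 i[%classic)).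
by move=> i; exact: measurable_itv.
Qed.

Lemma lebesgue_rV_open_box (l h : E) : (forall i, l 0 i < h 0 i) ->
  mu (open_box l h) = (\prod_(i < n) (h 0 i - l 0 i))%:E.
Proof.
move=> lh; rewrite /open_box.
have /= := @lebesgue_rV_box (fun i => `]l 0 i, h 0 i[%classic).
rewrite (_ : mkset _ = open_box l h); last first.
  by apply/seteqP; split => x /= H i; have := H i; rewrite in_itv.
move=> ->; last by move=> i; exact: measurable_itv.
rewrite -prodEFin; apply: eq_bigr => i _.
by rewrite lebesgue_measure_itv /= lte_fin lh -EFinB.
Qed.

Lemma lebesgue_rV_open_box_gt0 (l h : E) : (forall i, l 0 i < h 0 i) ->
  (0 < mu (open_box l h))%E.
Proof.
move=> lh; rewrite lebesgue_rV_open_box// lte_fin.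
by apply: prodr_gt0 => i _; rewrite subr_gt0.
Qed.

Lemma bounded_lebesgue_rV_lty (A : set E) : measurable A -> bounded_set A ->
  (mu A < +oo)%E.
Proof.
move=> mA [M [Mr HM]].
pose C := `|M| + 1 : R.
have C0 : 0 < C by rewrite /C ltr_wpDl.
have AC x : A x -> forall i, - (C + 1) < x 0 i < C + 1.
  move=> Ax i; rewrite -ltr_norml.
  have : `|x| <= C by apply: HM => //; rewrite /C (le_lt_trans (ler_norm M))// ltrDl.
  rewrite /Num.norm /= mx_normrE => /bigmax_leP[_ /(_ (0, i) isT) /=].
  by move=> /le_lt_trans; apply; rewrite ltrDl.
pose l : E := const_mx (- (C + 1)); pose h : E := const_mx (C + 1).
apply: (@le_lt_trans _ _ (mu (open_box l h))).
  apply: le_measure; rewrite ?inE//; first exact: measurable_open_box.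
  by move=> x Ax i; rewrite !mxE; exact: AC.
by rewrite lebesgue_rV_open_box ?ltry// => i; rewrite !mxE; lra.
Qed.

End lebesgue_rV_theory.

(** * Integration over the meshed domain *)

Section mesh_measure.
Variables (R : realType) (d : nat) (T : mesh R d).
Local Notation E := 'rV[R]_d.
Local Notation mu := (@lebesgue_rV R d).
Local Notation D := (dom T).
Local Notation ibox k := (open_box (@lo R d T k) (hi k)).

Lemma negligible_fin_bigcup (I : finType) (F : I -> set E) :
  (forall i, mu.-negligible (F i)) -> mu.-negligible (\bigcup_i F i).
Proof.
move=> F0; apply: (negligibleS (A := \big[setU/set0]_(i <- enum I) F i)).
  by rewrite -bigcup_seq => x [i _ Fix]; exists i => //=; rewrite mem_enum.
by elim/big_ind : _ => //; [exact: negligible_set0|exact: negligibleU].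
Qed.

(** The hyperplanes that carry the faces of the fine cells. Taking whole
    hyperplanes keeps the set null and makes it easy to avoid: off it, a point
    of a closed cell lies in the interior of that cell. *)
Definition face_planes : set E := \bigcup_k \bigcup_i
  ([set x : E | x 0 i = @lo R d T k 0 i] `|` [set x : E | x 0 i = hi k 0 i]).

Lemma negligible_faces : mu.-negligible face_planes.
Proof.
apply: negligible_fin_bigcup => k; apply: negligible_fin_bigcup => i.
by apply: negligibleU; (apply/negligibleP; [exact: measurable_hyperplane|
  exact: lebesgue_rV_hyperplane]).
Qed.

Lemma cell_off_faces k x : cell k x -> ~ face_planes x -> ibox k x.
Proof.
move=> xk nf i; have /andP[xl xh] := xk i; rewrite !lt_neqAle xl xh !andbT.
apply/andP; split; apply/negP => /eqP H; apply: nf; exists k => //; exists i => //=.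
  by left.
by right.
Qed.

Lemma open_box_cell k x : ibox k x -> cell k x.
Proof. by move=> xk i; have /andP[/ltW -> /ltW ->] := xk i. Qed.

Lemma dom_off_faces x : D x -> ~ face_planes x -> exists k, ibox k x.
Proof.
move=> /subset_closure; rewrite -cells_cover => -[k _ xk] nf.
by exists k; exact: cell_off_faces.
Qed.

Lemma open_box_inj k l x : ibox k x -> ibox l x -> k = l.
Proof.
move=> xk xl; apply/eqP; apply: contraT => /(@cells_disjoint R d T).
by move=> /seteqP[/(_ x (conj xk xl))].
Qed.

Lemma measurable_dom : measurable D.
Proof. by apply: open_measurable_rV; exact: dom_open. Qed.

Lemma lebesgue_dom_lty : (mu D < +oo)%E.
Proof. exact: bounded_lebesgue_rV_lty measurable_dom (dom_bounded T). Qed.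

(** Bounded measurable functions, up to a null set of the domain. They form an
    algebra on which the integral is linear, and it contains every function
    integrated below: the coefficient, finite element functions and their total
    derivatives, the characteristic functions and the eigenfunctions. *)
Definition tame (f : E -> R) := exists g : E -> R,
  [/\ measurable_fun setT g, exists C, forall x, `|g x| <= C &
      mu.-negligible [set x | D x /\ f x <> g x]].

Lemma tame_ae (f g : E -> R) : (forall x, D x -> ~ face_planes x -> f x = g x) ->
  tame f -> tame g.
Proof.
move=> fg [h [mh bh fh]]; exists h; split => //.
apply: negligibleS (negligibleU negligible_faces fh) => x [Dx gh].
by have [?|nf] := pselect (face_planes x); [left|right; split; rewrite ?fg].
Qed.

Lemma tame_cst (c : R) : tame (cst c).
Proof.
exists (cst c); split => //; first by exists `|c|.
by apply: negligibleS (negligible_set0 _) => x [].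
Qed.

Lemma tameD f g : tame f -> tame g -> tame (fun x => f x + g x).
Proof.
move=> [f' [mf [C Cf] nf]] [g' [mg [C' Cg] ng]].
exists (fun x => f' x + g' x); split; first exact: measurable_funD.
  by exists (C + C') => x; rewrite (le_trans (ler_normD _ _))// lerD.
apply: negligibleS (negligibleU nf ng) => x [Dx H].
have [e|ne] := pselect (f x = f' x); last by left.
by right; split => // e'; apply: H; rewrite e e'.
Qed.

Lemma tameM f g : tame f -> tame g -> tame (fun x => f x * g x).
Proof.
move=> [f' [mf [C Cf] nf]] [g' [mg [C' Cg] ng]].
exists (fun x => f' x * g' x); split; first exact: measurable_funM.
  by exists (C * C') => x; rewrite normrM ler_pM.
apply: negligibleS (negligibleU nf ng) => x [Dx H].
have [e|ne] := pselect (f x = f' x); last by left.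
by right; split => // e'; apply: H; rewrite e e'.
Qed.

Lemma tameZ c f : tame f -> tame (fun x => c * f x).
Proof. by move=> tf; apply: tameM => //; exact: tame_cst. Qed.

Lemma tame_sum (I : Type) (r : seq I) (P : pred I) (f : I -> E -> R) :
  (forall i, P i -> tame (f i)) -> tame (fun x => \sum_(i <- r | P i) f i x).
Proof.
move=> tf; rewrite (_ : (fun x => _) = \sum_(i <- r | P i) f i); last first.
  by apply/funext => x; rewrite fct_sumE.
elim/big_ind : _ => //; [exact: tame_cst|move=> ? ?; exact: tameD].
Qed.

Lemma tame_indic (A : set E) : measurable A -> tame \1_A.
Proof.
move=> mA; exists \1_A; split; first exact: measurable_indic.
  by exists 1 => x; rewrite indicE; case: (_ \in _); rewrite /= ?normr1 ?normr0.
by apply: negligibleS (negligible_set0 _) => x [].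
Qed.

(** Off a null set, a function is the sum of its restrictions to the interiors
    of the cells. *)
Lemma tame_cellwise f : (forall k, tame (fun x => \1_(ibox k) x * f x)) -> tame f.
Proof.
move=> tf; apply: (tame_ae _ (tame_sum (index_enum _) (fun k _ => tf k))) => x Dx nf.
have [k xk] := dom_off_faces Dx nf.
rewrite (bigD1 k)//= indicE mem_set// mul1r big1 ?addr0// => l lk.
rewrite indicE memNset ?mul0r// => xl.
by move: lk; rewrite (open_box_inj xl xk) eqxx.
Qed.

Definition integ (f : E -> R) : R := \int[mu]_(x in D) f x.

Lemma integ_ae f g : mu.-negligible [set x | D x /\ f x <> g x] ->
  integ f = integ g.
Proof.
move=> [N [mN N0 sub]]; apply: (eq_Rintegral_off_null mN N0) => x Dx Nx.
by apply: contrapT => H; apply: Nx; exact: sub.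
Qed.

Lemma integ_off_faces f g : (forall x, D x -> ~ face_planes x -> f x = g x) ->
  integ f = integ g.
Proof.
move=> fg; apply: integ_ae; apply: negligibleS negligible_faces => x [Dx H].
by apply: contrapT => nf; apply: H; exact: fg.
Qed.

Lemma bounded_integrable (g : E -> R) : measurable_fun setT g ->
  (exists C, forall x, `|g x| <= C) -> mu.-integrable D (EFin \o g).
Proof.
move=> mg [C HC]; apply: measurable_bounded_integrable.
- exact: measurable_dom.
- exact: lebesgue_dom_lty.
- exact: measurable_funTS.
exists C; split; first exact: num_real.
by move=> y Cy x _ /=; rewrite (le_trans (HC x))// ltW.
Qed.

Lemma integD f g : tame f -> tame g ->
  integ (fun x => f x + g x) = integ f + integ g.
Proof.
move=> [f' [mf Cf nf]] [g' [mg Cg ng]].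
rewrite (integ_ae nf) (integ_ae ng) -RintegralD; first last.
- exact: bounded_integrable.
- exact: bounded_integrable.
- exact: measurable_dom.
apply: integ_ae; apply: negligibleS (negligibleU nf ng) => x [Dx H].
have [e|ne] := pselect (f x = f' x); last by left.
by right; split => // e'; apply: H; rewrite e e'.
Qed.

Lemma integZ c f : tame f -> integ (fun x => c * f x) = c * integ f.
Proof.
move=> [f' [mf Cf nf]]; rewrite (integ_ae nf) -RintegralZl; first last.
- exact: bounded_integrable.
- exact: measurable_dom.
by apply: integ_ae; apply: negligibleS nf => x [Dx H]; split => // e; rewrite e in H.
Qed.

Lemma integ_ge0 f : (forall x, D x -> 0 <= f x) -> 0 <= integ f.
Proof. exact: Rintegral_ge0. Qed.

Lemma integ_indic (A : set E) : measurable A -> integ \1_A = fine (mu (A `&` D)).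
Proof.
by move=> mA; rewrite /integ /Rintegral integral_indic//; exact: measurable_dom.
Qed.

(** The integral dominates that of [c] times the indicator of [Q]. *)
Lemma integ_gt0 f (c : R) (Q : set E) : tame f -> (forall x, D x -> 0 <= f x) ->
  0 < c -> measurable Q -> (0 < mu Q)%E -> Q `<=` D -> (forall x, Q x -> c <= f x) ->
  0 < integ f.
Proof.
move=> tf f0 c0 mQ Q0 QD cf.
have tQ : tame (fun x => - c * \1_Q x) by apply: tameZ; exact: tame_indic.
have : 0 <= integ (fun x => f x + - c * \1_Q x).
  apply: integ_ge0 => x Dx; rewrite mulNr subr_ge0 indicE.
  by case: (boolP (x \in Q)); rewrite ?inE ?mulr1 ?mulr0 => *; [exact: cf|exact: f0].
rewrite integD// integZ; last exact: tame_indic.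
rewrite mulNr subr_ge0 integ_indic// setIidl//.
apply: lt_le_trans; rewrite mulr_gt0// fine_gt0// Q0 /=.
apply: le_lt_trans lebesgue_dom_lty; apply: le_measure; rewrite ?inE//.
exact: measurable_dom.
Qed.

End mesh_measure.

(** * Multilinear functions and their partial derivatives *)

Section multilinear.
Variables (R : realType) (d : nat).
Local Notation E := 'rV[R]_d.
Local Notation e_ i := (delta_mx 0 i : E).
Implicit Types (c : {set 'I_d} -> R) (x y : E) (i : 'I_d).

Definition mlin c x : R := \sum_(S : {set 'I_d}) c S * \prod_(i in S) x 0 i.

(** The [i]-th partial derivative of [mlin c]. *)
Definition dmlin i c x : R :=
  \sum_(S : {set 'I_d} | i \in S) c S * \prod_(j in S :\ i) x 0 j.

(** Each monomial contains a coordinate at most once, so a multilinear function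
    is affine along every coordinate line; this makes its difference quotients
    constant. *)
Lemma mlin_shift c i t x : mlin c (x + t *: e_ i) = mlin c x + t * dmlin i c x.
Proof.
have coordE j : (x + t *: e_ i) 0 j = x 0 j + t * (j == i)%:R.
  by rewrite !mxE eqxx.
rewrite /mlin /dmlin mulr_sumr [X in _ = _ + X]big_mkcond -big_split.
apply: eq_bigr => S _ /=; case: ifPn => iS; last first.
  rewrite addr0; congr (_ * _); apply: eq_bigr => j jS.
  by rewrite coordE (negbTE (memPn iS _ jS)) mulr0 addr0.
have prodE : \prod_(j in S :\ i) (x + t *: e_ i) 0 j = \prod_(j in S :\ i) x 0 j.
  by apply: eq_bigr => j /setD1P[/negbTE ji _]; rewrite coordE ji mulr0 addr0.
by rewrite !(big_setD1 i iS)/= prodE coordE eqxx mulr1; ring.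
Qed.

Lemma continuous_monomial (S : {set 'I_d}) :
  continuous (fun x : E => \prod_(i in S) x 0 i).
Proof.
rewrite (_ : (fun x => _) = \prod_(i in S) (fun x : E => x 0 i)); last first.
  by apply/funext => x; rewrite fct_prodE.
elim/big_ind : _ => [|f g cf cg|i _ x]; first exact: cst_continuous.
  by move=> x; exact: cvgM (cf x) (cg x).
exact: coord_continuous.
Qed.

Lemma continuous_dmlin i c : continuous (dmlin i c).
Proof.
rewrite (_ : dmlin i c = \sum_(S : {set 'I_d} | i \in S)
    (fun x : E => c S * \prod_(j in S :\ i) x 0 j)); last first.
  by apply/funext => x; rewrite fct_sumE.
elim/big_ind : _ => [|f g cf cg|S _ x]; first exact: cst_continuous.
  by move=> x; exact: cvgD (cf x) (cg x).
exact: (cvgM (cvg_cst (c S)) (@continuous_monomial (S :\ i)%SET x)).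
Qed.

Lemma is_derive_mlin c i x (l h : E) (u : E -> R) :
  open_box l h x -> (forall y, open_box l h y -> u y = mlin c y) ->
  is_derive x (e_ i) u (dmlin i c x).
Proof.
move=> xB uE.
pose e := Num.min (x 0 i - l 0 i) (h 0 i - x 0 i).
have e0 : 0 < e by have /andP[a b] := xB i; rewrite lt_min !subr_gt0 a b.
have H : (fun t => t^-1 *: ((u \o shift x) (t *: e_ i) - u x)) @ 0^' --> dmlin i c x.
  apply: cvg_near_cst; near=> t.
  have t0 : t != 0 by near: t; exact: nbhs_dnbhs_neq.
  have te : `|t| < e.
    by near: t; exact: dnbhs0_lt.
  have tB : open_box l h (x + t *: e_ i).
    move: te; rewrite /e lt_min !ltr_norml => /andP[/andP[t1 t2] /andP[t3 t4]] j.
    rewrite !mxE eqxx /=; case: eqP => [->|_]; rewrite ?mulr1 ?mulr0 ?addr0.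
      by apply/andP; split; lra.
    exact: xB.
  rewrite /= [_ + x]addrC (uE _ tB) (uE _ xB) mlin_shift [_ - _]addrC addKr.
  by rewrite /GRing.scale /= mulrA mulVf// mul1r.
split; first by apply/cvg_ex; exists (dmlin i c x).
exact/cvg_lim.
Unshelve. all: by end_near. Qed.
End multilinear.

Section piecewise_multilinear.
Variables (R : realType) (d : nat) (T : mesh R d).
Local Notation E := 'rV[R]_d.
Local Notation mu := (@lebesgue_rV R d).
Local Notation D := (dom T).
Local Notation ibox k := (open_box (@lo R d T k) (hi k)).
Local Notation e_ i := (delta_mx 0 i : E).

Lemma tame_monomial k (S : {set 'I_d}) :
  tame T (fun x => \1_(ibox k) x * \prod_(i in S) x 0 i).
Proof.
exists (fun x => \1_(ibox k) x * \prod_(i in S) x 0 i); split.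
- apply: measurable_funM; first by apply: measurable_indic; exact: measurable_open_box.
  rewrite (_ : (fun x => _) = (fun x : E => \prod_(i <- enum S) x 0 i)).
    by apply: measurable_prod => i _; exact: measurable_coord.
  by apply/funext => x; rewrite big_enum.
- exists (\prod_(i in S) (`|@lo R d T k 0 i| + `|hi k 0 i|)) => x.
  rewrite indicE; case: (boolP (_ \in _)) => [|_]; last first.
    by rewrite mul0r normr0; apply: prodr_ge0 => i _; rewrite addr_ge0.
  rewrite inE mul1r normr_prod => xk; apply: ler_prod => i _.
  rewrite normr_ge0 /= ler_norml.
  have /andP[xl xh] := xk i.
  have := ler_norm (hi k 0 i); have := ler_norm (- @lo R d T k 0 i).
  have := normr_ge0 (hi k 0 i); have := normr_ge0 (@lo R d T k 0 i).
  by rewrite normrN => *; apply/andP; split; lra.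
by apply: negligibleS (negligible_set0 _) => x [].
Qed.

Lemma tame_mlin k c : tame T (fun x => \1_(ibox k) x * mlin c x).
Proof.
rewrite (_ : (fun x => _) = fun x => \sum_(S : {set 'I_d})
   c S * (\1_(ibox k) x * \prod_(i in S) x 0 i)).
  by apply: tame_sum => S _; apply: tameZ; exact: tame_monomial.
by apply/funext => x; rewrite mulr_sumr; apply: eq_bigr => S _; rewrite mulrCA.
Qed.

Lemma tame_dmlin k i c : tame T (fun x => \1_(ibox k) x * dmlin i c x).
Proof.
rewrite (_ : (fun x => _) = fun x => \sum_(S : {set 'I_d} | i \in S)
   c S * (\1_(ibox k) x * \prod_(j in S :\ i) x 0 j)).
  by apply: tame_sum => S _; apply: tameZ; exact: tame_monomial.
by apply/funext => x; rewrite mulr_sumr; apply: eq_bigr => S _; rewrite mulrCA.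
Qed.

Definition cellwise_multilinear (u : E -> R) : Prop :=
  forall k, multilinear_on (@cell R d T k) u.

Lemma cellwise_multilinearD u v : cellwise_multilinear u ->
  cellwise_multilinear v -> cellwise_multilinear (u + v).
Proof.
move=> Hu Hv k; have [c Hc] := Hu k; have [c' Hc'] := Hv k.
exists (c + c') => x xk; transitivity (u x + v x) => //; rewrite Hc// Hc'//.
under [RHS]eq_bigr => S _ do rewrite (_ : (c + c') S = c S + c' S)// mulrDl.
by rewrite big_split.
Qed.

Lemma cellwise_multilinearZ a u : cellwise_multilinear u ->
  cellwise_multilinear (a *: u).
Proof.
move=> Hu k; have [c Hc] := Hu k.
exists (a *: c) => x xk; transitivity (a * u x) => //; rewrite Hc// mulr_sumr.
by apply: eq_bigr => S _; rewrite mulrA.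
Qed.

Lemma tame_cellwise_multilinear u : cellwise_multilinear u -> tame T u.
Proof.
move=> Hu; apply: tame_cellwise => k; have [c Hc] := Hu k.
apply: (tame_ae _ (tame_mlin k c)) => x _ _.
rewrite indicE; case: (boolP (_ \in _)) => [|_]; last by rewrite !mul0r.
by rewrite inE => xk; rewrite Hc//; exact: open_box_cell.
Qed.

Lemma cellwise_derive u k : cellwise_multilinear u ->
  exists c, (forall x, cell k x -> u x = mlin c x) /\
    forall i x, ibox k x -> is_derive x (e_ i) u (dmlin i c x).
Proof.
move=> Hu; have [c Hc] := Hu k; exists c; split => // i x xk.
have uE y : ibox k y -> u y = mlin c y by move=> yk; apply: Hc; exact: open_box_cell.
exact: (is_derive_mlin i xk uE).
Qed.

Lemma tame_grad u i : cellwise_multilinear u -> tame T ('D_(e_ i) u).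
Proof.
move=> Hu; apply: tame_cellwise => k; have [c [_ Hc]] := cellwise_derive k Hu.
apply: (tame_ae _ (tame_dmlin k i c)) => x _ _.
rewrite indicE; case: (boolP (_ \in _)) => [|_]; last by rewrite !mul0r.
by rewrite inE => xk; rewrite (@derive_val _ _ _ _ _ _ _ (Hc i x xk)).
Qed.

Lemma cellwise_derivable u i x : cellwise_multilinear u -> D x -> ~ face_planes T x ->
  derivable u x (e_ i).
Proof.
move=> Hu Dx nf; have [k xk] := dom_off_faces Dx nf.
by have [c [_ Hc]] := cellwise_derive k Hu; have := Hc i x xk => -[].
Qed.

End piecewise_multilinear.

(** * The L2 and energy forms *)

Section bilinear_forms.
Variables (R : realType) (d : nat) (T : mesh R d).
Local Notation E := 'rV[R]_d.
Local Notation D := (dom T).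
Local Notation ibox k := (open_box (@lo R d T k) (hi k)).
Local Notation e_ i := (delta_mx 0 i : E).

Lemma innerE u v : inner T u v = integ T (fun x => u x * v x).
Proof. by []. Qed.

Lemma innerC u v : inner T u v = inner T v u.
Proof. by congr (integ T _); apply/funext => x; rewrite mulrC. Qed.

Lemma innerDl u v w : tame T u -> tame T v -> tame T w ->
  inner T (u + v) w = inner T u w + inner T v w.
Proof.
move=> tu tv tw; rewrite !innerE -integD; [|exact: tameM|exact: tameM].
by congr (integ T _); apply/funext => x; rewrite -mulrDl.
Qed.

Lemma innerZl c u w : tame T u -> tame T w -> inner T (c *: u) w = c * inner T u w.
Proof.
move=> tu tw; rewrite !innerE -integZ; last exact: tameM.
by congr (integ T _); apply/funext => x; rewrite mulrA.
Qed.

Lemma inner_ge0 u : 0 <= inner T u u.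
Proof. by apply: integ_ge0 => x _; rewrite -expr2 sqr_ge0. Qed.

Variables (kappa : E -> R) (kappa0 kappa1 : R).
Hypothesis mkappa : measurable_fun D kappa.
Hypothesis kappa0_gt0 : 0 < kappa0.
Hypothesis kappa_bound : forall x, D x -> kappa0 <= kappa x <= kappa1.

Let kappa_ge0 x : D x -> 0 <= kappa x.
Proof. by move=> /kappa_bound /andP[+ _]; apply: le_trans; exact: ltW. Qed.

Lemma tame_kappa : tame T kappa.
Proof.
exists (kappa \_ D); split.
- by apply/(measurable_restrictT _ (measurable_dom T)).
- exists `|kappa1| => x; rewrite /patch; case: ifPn; last by rewrite normr0.
  rewrite inE => Dx; have /andP[_ k1] := kappa_bound Dx.
  by rewrite (ger0_norm (kappa_ge0 Dx)) (le_trans k1)// ler_norm.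
apply: negligibleS (negligible_set0 _) => x [Dx]; apply.
by rewrite /patch mem_set.
Qed.

Local Notation cwm := (@cellwise_multilinear R d T).
Local Notation a := (energy T kappa).

Definition flux (u v : E -> R) (x : E) : R :=
  kappa x * \sum_(i < d) 'D_(e_ i) u x * 'D_(e_ i) v x.

Lemma energyE u v : a u v = integ T (flux u v).
Proof. by []. Qed.

Lemma tame_flux u v : cwm u -> cwm v -> tame T (flux u v).
Proof.
move=> Hu Hv; apply: tameM tame_kappa _; apply: tame_sum => i _.
by apply: tameM; exact: tame_grad.
Qed.

Lemma energyC u v : a u v = a v u.
Proof.
congr (integ T _); apply/funext => x; congr (_ * _).
by apply: eq_bigr => i _; rewrite mulrC.
Qed.

(** The derivative of a sum is the sum of the derivatives only in the interior
    of the cells, which is enough for the integrals. *)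
Lemma energyDl u v w : cwm u -> cwm v -> cwm w -> a (u + v) w = a u w + a v w.
Proof.
move=> Hu Hv Hw; rewrite !energyE -integD; [|exact: tame_flux|exact: tame_flux].
apply: integ_off_faces => x Dx nf; rewrite /flux -mulrDr -big_split.
congr (_ * _); apply: eq_bigr => i _ /=.
by rewrite deriveD ?mulrDl//; exact: cellwise_derivable.
Qed.

Lemma energyZl c u w : cwm u -> cwm w -> a (c *: u) w = c * a u w.
Proof.
move=> Hu Hw; rewrite !energyE -integZ; last exact: tame_flux.
apply: integ_off_faces => x Dx nf; rewrite /flux mulrCA.
congr (_ * _); rewrite mulr_sumr; apply: eq_bigr => i _ /=.
by rewrite deriveZ ?mulrA//; exact: cellwise_derivable.
Qed.

Lemma flux_ge0 u x : D x -> 0 <= flux u u x.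
Proof.
move=> Dx; rewrite mulr_ge0 ?kappa_ge0//.
by apply: sumr_ge0 => i _; rewrite -expr2 sqr_ge0.
Qed.

Lemma energy_ge0 u : 0 <= a u u.
Proof. by apply: integ_ge0 => x; exact: flux_ge0. Qed.

(** Otherwise the partial derivative is, by continuity, larger than some
    [g > 0] in absolute value on the part of the cell near [x]. This part
    contains a box of positive measure, also when [x] is on the boundary of the
    cell, and the integrand of the energy is at least [kappa0 * g ^+ 2] there. *)
Lemma energy0_dmlin u k c i x : cwm u -> a u u = 0 ->
  (forall i x, ibox k x -> is_derive x (e_ i) u (dmlin i c x)) ->
  cell k x -> dmlin i c x = 0.
Proof.
move=> Hu u0 Hc xk; apply: contra_eq u0 => g0.
set g := `|dmlin i c x| / 2.
have g_gt0 : 0 < g by rewrite divr_gt0// normr_gt0.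
have : \forall y \near x, g < `|dmlin i c y|.
  apply: (cvgr_norm_gt _ (@continuous_dmlin R d i c x)).
  by rewrite /g; have := normr_gt0 (dmlin i c x); rewrite g0 => ?; lra.
move=> /nbhs_ballP[e /= e0 He].
pose l : E := \row_j Num.max (@lo R d T k 0 j) (x 0 j - e).
pose h : E := \row_j Num.min (hi k 0 j) (x 0 j + e).
have lh j : l 0 j < h 0 j.
  have /andP[? ?] := xk j; have := @lo_lt_hi R d T k j.
  by rewrite !mxE gt_max !lt_min => ->; rewrite /=; lra.
have Qk : open_box l h `<=` ibox k.
  move=> y Qy j; have := Qy j; rewrite !mxE gt_max lt_min.
  by move=> /andP[/andP[-> _] /andP[->]].
have Qg y : open_box l h y -> g < `|dmlin i c y|.
  move=> Qy; apply: He; split => // j' j; rewrite ord1 /ball /=.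
  have := Qy j; rewrite !mxE gt_max lt_min ltr_norml.
  by move=> /andP[/andP[_ ?] /andP[_ ?]]; apply/andP; split; lra.
rewrite gt_eqF// energyE.
apply: (@integ_gt0 _ _ _ _ (kappa0 * g ^+ 2) (open_box l h)).
- exact: tame_flux.
- by move=> y; exact: flux_ge0.
- by rewrite mulr_gt0// exprn_gt0.
- exact: measurable_open_box.
- exact: lebesgue_rV_open_box_gt0.
- by move=> y /Qk; exact: (@cells_in_dom R d T k).
move=> y Qy; have Dy := @cells_in_dom R d T k _ (Qk _ Qy).
have /andP[ky _] := kappa_bound Dy.
apply: ler_pM => //; [exact: ltW|by rewrite exprn_ge0// ltW|].
rewrite (bigD1 i)//= (@derive_val _ _ _ _ _ _ _ (Hc i y (Qk _ Qy))).
apply: (@le_trans _ _ (dmlin i c y * dmlin i c y)).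
  by rewrite -expr2 -[leRHS]real_normK ?num_real// lerXn2r ?nnegrE// ltW// Qg.
by rewrite lerDl; apply: sumr_ge0 => j _; rewrite -expr2 sqr_ge0.
Qed.

(** Move from the lower corner to [x] by changing one coordinate at a time; by
    [mlin_shift] no move changes the value. *)
Lemma mlin_cst k (c : {set 'I_d} -> R) x : 
  (forall i y, cell k y -> dmlin i c y = 0) -> cell k x ->
  mlin c x = mlin c (@lo R d T k).
Proof.
move=> c0 xk.
pose z m : E := \row_j (if (j < m)%N then x 0 j else @lo R d T k 0 j).
have zk m : cell k (z m).
  move=> j; rewrite mxE; case: ifP => _; first exact: xk.
  by rewrite lexx ltW// lo_lt_hi.
have z0 : z 0%N = lo k by apply/rowP => j; rewrite mxE ltn0.
have zd : z d = x by apply/rowP => j; rewrite mxE ltn_ord.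
suff H m : (m <= d)%N -> mlin c (z m) = mlin c (z 0%N) by rewrite -zd H// z0.
elim: m => // m IH md; rewrite -IH ?(ltnW md)//.
pose i := Ordinal md.
rewrite (_ : z m.+1 = z m + (x 0 i - @lo R d T k 0 i) *: e_ i).
  by rewrite mlin_shift c0// mulr0 addr0.
apply/rowP => j; rewrite !mxE eqxx ltnS leq_eqVlt; case: (eqVneq j i) => [->|ji] /=.
  by rewrite eqxx ltnn mulr1 addrC subrK.
rewrite mulr0 addr0; suff /negbTE -> : (j : nat) != m by [].
by apply: contra ji => /eqP jm; apply/eqP/val_inj.
Qed.

(** A function of zero energy is constant on each cell. If it takes a nonzero
    value [u x], take a cell with this value that extends furthest in the first
    coordinate direction. The far face of this cell lies in the domain, because
    [u] vanishes outside. A point just beyond that face lies in a cell that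
    extends further, where [u] has therefore another value. As there are only
    finitely many cell values, this contradicts continuity. *)
Lemma energy_eq0 u : (0 < d)%N -> fe_space T u -> a u u = 0 -> u = 0.
Proof.
move=> d0 [cu Hu u_out] u0; pose i0 := Ordinal d0.
have ucst k x : @cell R d T k x -> u x = u (lo k).
  have [c [uE uD]] := cellwise_derive k Hu => xk.
  rewrite !uE//; last by move=> j; rewrite lexx ltW// lo_lt_hi.
  by apply: (mlin_cst (k := k)) => // i y; exact: energy0_dmlin.
have dom_cell x : D x -> exists k, @cell R d T k x.
  by move=> /subset_closure; rewrite -cells_cover => -[k _ xk]; exists k.
apply/funext => x; apply/eqP; apply: contraT => ux0.
have nz_dom y : u y != 0 -> D y.
  by move=> uy; apply: contrapT => /u_out/eqP; apply/negP.
have [k0 xk0] := dom_cell x (nz_dom x ux0).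
case: (@Order.TotalTheory.arg_maxP _ _ _ k0 (fun k => u (@lo R d T k) == u x)
  (fun k => hi k 0 i0)); first by rewrite -(ucst _ _ xk0).
move=> k /eqP uk kmax.
pose y : E := \row_j (if j == i0 then hi k 0 i0 else @lo R d T k 0 j).
have yk : cell k y.
  move=> j; have := @lo_lt_hi R d T k j; rewrite mxE.
  by case: eqP => [->|_] /ltW h; rewrite lexx h.
have uy : u y = u x by rewrite (ucst _ _ yk).
have Dy : D y by apply: nz_dom; rewrite uy.
have cuy : {for y, continuous u}.
  have := continuous_subspaceW (@subset_closure _ D) cu.
  by rewrite continuous_open_subspace; [apply; rewrite inE|exact: dom_open].
have : \forall z \near y, D z /\ forall l, u (@lo R d T l) != u x -> u z != u (lo l).
  apply: filterI; first by apply: open_nbhs_nbhs; split => //; exact: dom_open.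
  have := @filter_forall E _ (fun l z => u (@lo R d T l) != u x -> u z != u (lo l)) _
    (nbhs_filter y).
  apply => l.
  case: (eqVneq (u (lo l)) (u x)) => [_|ne]; first exact: nearW.
  have uyl : u y - u (lo l) != 0 by rewrite uy subr_eq0 eq_sym.
  have FF := nbhs_filter y.
  have := @cvgr_neq0 _ _ _ _ FF (fun z => u z - u (lo l)) _ (@cvgB _ _ _ _ FF _ _ _ _ cuy (@cvg_cst _ _ _ _ FF)) uyl.
  by apply: filterS => z; rewrite subr_eq0.
move=> /nbhs_ballP[e /= e0 He].
pose z := y + (e / 2) *: e_ i0.
have zE j : z 0 j = y 0 j + (e / 2) * (j == i0)%:R by rewrite !mxE eqxx.
have [Dz zl] : D z /\ forall l, u (@lo R d T l) != u x -> u z != u (lo l).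
  apply: He; split => // j' j; rewrite ord1 zE /ball /= opprD addNKr normrN.
  by case: eqP => _; rewrite ?mulr1 ?mulr0 ?normr0// gtr0_norm; lra.
have [l zlc] := dom_cell z Dz.
(* so close to [y], no cell value other than [u x] can occur *)
have ul : u (lo l) == u x by apply: contraT => /zl; rewrite (ucst _ _ zlc) eqxx.
have lmax : hi l 0 i0 <= hi k 0 i0 := kmax l ul.
by have /andP[_] := zlc i0; rewrite zE /y mxE eqxx mulr1 => ?; lra.
Qed.

End bilinear_forms.

(** * Symmetric bilinear forms on a subspace *)

Section symmetric_forms.
Variables (R : realType) (V : lmodType R).
Implicit Types (W : set V) (a : V -> V -> R).

(** The forms of interest live on all functions but are bilinear only where the
    integrands are integrable and derivatives are additive. Hence bilinearity is
    stated relative to a linear subspace [W]. *)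
Definition subspace_pred W : Prop :=
  [/\ W 0, forall u v, W u -> W v -> W (u + v) & forall c u, W u -> W (c *: u)].

Definition symmetric_form_on W a : Prop :=
  [/\ forall u v, a u v = a v u,
      forall u v w, W u -> W v -> W w -> a (u + v) w = a u w + a v w &
      forall c u w, W u -> W w -> a (c *: u) w = c * a u w].

Variables (W : set V).
Hypothesis subW : subspace_pred W.

Lemma subspace0 : W 0. Proof. by case: subW. Qed.
Lemma subspaceD u v : W u -> W v -> W (u + v). Proof. by case: subW => _ + _; apply. Qed.
Lemma subspaceZ c u : W u -> W (c *: u). Proof. by case: subW => _ _; apply. Qed.
Lemma subspaceB u v : W u -> W v -> W (u - v).
Proof. by move=> Wu Wv; rewrite -scaleN1r; apply: subspaceD => //; exact: subspaceZ. Qed.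
Lemma subspace_sum (I : finType) (c : I -> R) (f : I -> V) :
  (forall i, W (f i)) -> W (\sum_i c i *: f i).
Proof.
move=> Wf; elim/big_ind : _ => [|u v|i _]; [exact: subspace0|exact: subspaceD|].
exact: subspaceZ.
Qed.

Variable a : V -> V -> R.
Hypothesis forma : symmetric_form_on W a.

Lemma sformC u v : a u v = a v u. Proof. by case: forma. Qed.
Lemma sformDl u v w : W u -> W v -> W w -> a (u + v) w = a u w + a v w.
Proof. by case: forma => _ + _; apply. Qed.
Lemma sformZl c u w : W u -> W w -> a (c *: u) w = c * a u w.
Proof. by case: forma => _ _; apply. Qed.
Lemma sformDr u v w : W u -> W v -> W w -> a w (u + v) = a w u + a w v.
Proof. by move=> *; rewrite sformC sformDl// !(sformC w). Qed.
Lemma sformZr c u w : W u -> W w -> a w (c *: u) = c * a w u.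
Proof. by move=> *; rewrite sformC sformZl// sformC. Qed.
Lemma sformBl u v w : W u -> W v -> W w -> a (u - v) w = a u w - a v w.
Proof.
move=> Wu Wv Ww; rewrite -scaleN1r sformDl//; last exact: subspaceZ.
by rewrite sformZl// mulN1r.
Qed.
Lemma sformBr u v w : W u -> W v -> W w -> a w (u - v) = a w u - a w v.
Proof. by move=> *; rewrite sformC sformBl// !(sformC w). Qed.
Lemma sform_suml (I : finType) (c : I -> R) (f : I -> V) w :
  (forall i, W (f i)) -> W w -> a (\sum_i c i *: f i) w = \sum_i c i * a (f i) w.
Proof.
move=> Wf Ww; pose P (s : V) (t : R) := W s /\ a s w = t.
suff [] : P (\sum_i c i *: f i) (\sum_i c i * a (f i) w) by [].
apply: (big_rec2 P) => [|i y1 y2 _ [Wy <-]].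
  split; first exact: subspace0.
  by rewrite -(scale0r w) sformZl// mul0r.
by split; [apply: subspaceD => //|rewrite sformDl ?sformZl//]; exact: subspaceZ.
Qed.

End symmetric_forms.

(** * Conservation of the discrete energy *)

Section energy_conservation.
Variables (R : realType) (V : lmodType R) (W : set V) (a b : V -> V -> R).
Hypotheses (subW : subspace_pred W).
Hypotheses (forma : symmetric_form_on W a) (formb : symmetric_form_on W b).

(** The discrete energy at the half step between [n] and [n+1], where [x], [y]
    are the components of the implicit part at the times [n+1] and [n], and [X],
    [Y] those of the explicit part. *)
Definition scheme_energy (tau : R) (x y X Y : V) : R :=
  b (x + X - (y + Y)) (x + X - (y + Y))
  + tau ^+ 2 / 2 * ((a x x + a y y) + (a X X + a Y Y))
  + tau ^+ 2 * a X y + tau ^+ 2 * a x Y - tau ^+ 2 / 2 * a (X - Y) (X - Y).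

(** Testing the second difference with the centred difference telescopes. *)
Lemma form_second_difference p q r : W p -> W q -> W r ->
  b (p - 2 *: q + r) (p - r) = b (p - q) (p - q) - b (q - r) (q - r).
Proof.
move=> Wp Wq Wr; have W2q : W (2 *: q) by exact: subspaceZ.
have Wpq : W (p - q) by exact: subspaceB.
have Wqr : W (q - r) by exact: subspaceB.
have Wpr : W (p - r) by exact: subspaceB.
have Wp2q : W (p - 2 *: q) by exact: subspaceB.
rewrite (sformDl formb)// !(sformBl subW formb)// (sformZl formb)//.
rewrite !(sformBr subW formb)// (sformC formb q p) (sformC formb r p) (sformC formb r q).
ring.
Qed.

(** Testing both equations of the scheme with the centred difference of the
    corresponding component and adding them gives exactly the increment of the
    energy. The last term of the energy turns the squares of [X] and [Y] into the
    mixed term [2 * a X Y], the form in which the explicit part enters here. *)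
Lemma scheme_energy_conserved (tau : R) (x y z X Y Z : V) :
  W x -> W y -> W z -> W X -> W Y -> W Z ->
  b (x + X - 2 *: (y + Y) + (z + Z)) (x - z)
    + tau ^+ 2 / 2 * a (x + z + 2 *: Y) (x - z) = 0 ->
  b (x + X - 2 *: (y + Y) + (z + Z)) (X - Z) + tau ^+ 2 * a (y + Y) (X - Z) = 0 ->
  scheme_energy tau x y X Y = scheme_energy tau y z Y Z.
Proof.
move=> Wx Wy Wz WX WY WZ.
have WD := subspaceD subW; have WB := subspaceB subW; have WM := subspaceZ subW.
set p := x + X; set q := y + Y; set r := z + Z.
have Wp : W p by exact: WD.
have Wq : W q by exact: WD.
have Wr : W r by exact: WD.
have Wxz : W (x - z) by exact: WB.
have WXZ : W (X - Z) by exact: WB.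
have W2Y : W (2 *: Y) by exact: WM.
have Wp2q : W (p - 2 *: q + r) by apply: (WD) => //; apply: (WB) => //; exact: WM.
have := form_second_difference Wp Wq Wr.
have -> : p - r = (x - z) + (X - Z) by rewrite /p /r opprD addrACA.
rewrite (sformDr formb)// /scheme_energy -/p -/q -/r.
move: (b _ (x - z)) (b _ (X - Z)) => b1 b2 bE.
have sqE u v : W u -> W v -> a (u - v) (u - v) = a u u - 2 * a u v + a v v.
  move=> Wu Wv; have Wuv := WB _ _ Wu Wv.
  by rewrite (sformBl subW forma)// !(sformBr subW forma)// (sformC forma v u); ring.
rewrite !sqE//.
rewrite (sformDl forma (WD _ _ Wx Wz) W2Y Wxz) (sformDl forma Wx Wz Wxz).
rewrite (sformZl forma 2 WY Wxz) (sformDl forma Wy WY WXZ) !(sformBr subW forma)//.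
rewrite (sformC forma z x) (sformC forma Y x) (sformC forma Y X) (sformC forma X y).
move=> h1 h2.
lra.
Qed.
End energy_conservation.

(** * The angle between two independent finite families *)

Section angle.
Variables (R : realType).

(** On the unit sphere, which is compact, [q] has a positive minimum and [p] a
    maximum; both functions are homogeneous of degree 2. *)
Lemma quadratic_domination n (p q : 'rV[R]_n -> R) :
  continuous p -> continuous q ->
  (forall t x, p (t *: x) = t ^+ 2 * p x) ->
  (forall t x, q (t *: x) = t ^+ 2 * q x) ->
  (forall x, x != 0 -> 0 < q x) ->
  exists2 e, 0 < e & forall x, e * p x <= q x.
Proof.
move=> cp cq hp hq q0.
pose S := [set x : 'rV[R]_n | `|x| = 1].
have p0 : p 0 = 0 by rewrite -(scale0r 0) hp expr0n mul0r.
have q00 : q 0 = 0 by rewrite -(scale0r 0) hq expr0n mul0r.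
have unit x : x != 0 -> S (`|x|^-1 *: x).
  by move=> x0; rewrite /S /= normrZ normfV normr_id mulVf// normr_eq0.
have [[x0 Sx0]|S0] := pselect (S !=set0); last first.
  exists 1 => // x; have [->|/unit Sx] := eqVneq x 0; first by rewrite p0 q00 mulr0.
  by exfalso; apply: S0; exists (`|x|^-1 *: x).
have cS : compact S.
  apply: bounded_closed_compact.
    by exists 1; split; [exact: num_real|move=> M M1 x /= ->; exact: ltW].
  apply: (closed_comp (f := fun x : 'rV[R]_n => `|x|) (D := [set 1])).
    by move=> x _; exact: norm_continuous.
  exact: closed_eq.
have S0 : S !=set0 by exists x0.
have [c Sc cmin] := compact_EVT_min S0 cS (continuous_subspaceT cq).
have [c' _ cmax] := compact_EVT_max S0 cS (continuous_subspaceT cp).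
have qc : 0 < q c.
  apply: q0; move: Sc; rewrite inE /S /= => c1.
  by apply/eqP => c0; move: c1; rewrite c0 normr0 => /eqP; rewrite eq_sym oner_eq0.
have M0 : 0 < `|p c'| + 1 by rewrite ltr_wpDl.
exists (q c / (`|p c'| + 1)); first by rewrite divr_gt0.
move=> x; have [->|x0'] := eqVneq x 0; first by rewrite p0 q00 mulr0.
have Sx := unit _ x0'.
have xE : x = `|x| *: (`|x|^-1 *: x) by rewrite scalerA divff ?scale1r// normr_eq0.
rewrite xE hp hq mulrCA ler_wpM2l ?sqr_ge0//.
apply: le_trans (cmin _ (mem_set Sx)); rewrite mulrAC ler_pdivrMr//.
apply: ler_wpM2l; first exact: ltW.
apply: le_trans (cmax _ (mem_set Sx)) _.
by rewrite (le_trans (ler_norm _))// lerDl.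
Qed.

Variables (V : lmodType R) (W : set V) (a : V -> V -> R).
Hypotheses (subW : subspace_pred W) (forma : symmetric_form_on W a).
Hypothesis a_ge0 : forall u, W u -> 0 <= a u u.
Hypothesis a_eq0 : forall u, W u -> a u u = 0 -> u = 0.

(** Linear combinations parametrised by row vectors, so that compactness in
    the coefficient space applies. *)
Definition comb (I : finType) (F : I -> V) (x : 'rV[R]_#|I|) : V :=
  \sum_i x 0 (enum_rank i) *: F i.

Lemma combZ (I : finType) (F : I -> V) t x : comb F (t *: x) = t *: comb F x.
Proof.
by rewrite /comb scaler_sumr; apply: eq_bigr => i _; rewrite mxE scalerA.
Qed.

Lemma continuous_comb (I : finType) (F : I -> V) : (forall i, W (F i)) ->
  continuous (fun x => a (comb F x) (comb F x)).
Proof.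
move=> WF.
rewrite (_ : (fun x => _) = \sum_i \sum_j
    (fun x : 'rV[R]_#|I| => x 0 (enum_rank i) * (x 0 (enum_rank j) * a (F j) (F i)))).
  elim/big_ind : _ => [|f g cf cg x|i _]; first exact: cst_continuous.
    exact: cvgD (cf x) (cg x).
  elim/big_ind : _ => [|f g cf cg x|j _ x]; first exact: cst_continuous.
    exact: cvgD (cf x) (cg x).
  have cc k := @coord_continuous R 1 #|I| 0 k x.
  exact: (cvgM (cc (enum_rank i)) (cvgM (cc (enum_rank j)) (cvg_cst (a (F j) (F i))))).
apply/funext => x; rewrite fct_sumE (sform_suml subW forma)//; last exact: subspace_sum.
apply: eq_bigr => i _; rewrite fct_sumE (sformC forma) (sform_suml subW forma)//.
by rewrite mulr_sumr.
Qed.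

Variables (I1 I2 : finType) (f1 : I1 -> V) (f2 : I2 -> V).
Hypotheses (Wf1 : forall i, W (f1 i)) (Wf2 : forall i, W (f2 i)).
Hypothesis indep : forall c d, \sum_i c i *: f1 i = \sum_j d j *: f2 j ->
  (forall i, c i = 0) /\ (forall j, d j = 0).

(** Both sides are quadratic in the joint vector of coefficients, and the right
    one is positive definite because the two families are jointly independent. *)
Lemma angle_gap : exists2 e, 0 < e & forall c d,
  let u1 := \sum_i c i *: f1 i in let u2 := \sum_j d j *: f2 j in
  e * (a u1 u1 + a u2 u2) <= a (u1 - u2) (u1 - u2).
Proof.
pose F1 (i : I1 + I2) := if i is inl p then f1 p else 0.
pose F2 (i : I1 + I2) := if i is inr p then f2 p else 0.
pose F i := F1 i - F2 i.
have WF1 i : W (F1 i) by case: i => i /=; [|exact: subspace0].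
have WF2 i : W (F2 i) by case: i => i /=; [exact: subspace0|].
have WF i : W (F i) by exact: subspaceB.
have combE x : comb F x = comb F1 x - comb F2 x.
  by rewrite /comb -sumrB; apply: eq_bigr => i _; rewrite scalerBr.
have comb1 x : comb F1 x = \sum_i x 0 (enum_rank (inl i : I1 + I2)) *: f1 i.
  by rewrite /comb big_sumType /= [X in _ + X]big1 ?addr0// => i _; rewrite scaler0.
have comb2 x : comb F2 x = \sum_i x 0 (enum_rank (inr i : I1 + I2)) *: f2 i.
  by rewrite /comb big_sumType /= [X in X + _]big1 ?add0r// => i _; rewrite scaler0.
have Wcomb (I : finType) (G : I -> V) x : (forall i, W (G i)) -> W (comb G x) by exact: subspace_sum.
have sqZ (G : I1 + I2 -> V) t x : (forall i, W (G i)) ->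
    a (comb G (t *: x)) (comb G (t *: x)) = t ^+ 2 * a (comb G x) (comb G x).
  move=> WG; have Wc := Wcomb _ _ x WG.
  have Wtc := subspaceZ subW t Wc.
  by rewrite combZ (sformZl forma)// (sformZr forma)// mulrA.
have [|||||e e0 He] := @quadratic_domination _
  (fun x => a (comb F1 x) (comb F1 x) + a (comb F2 x) (comb F2 x))
  (fun x => a (comb F x) (comb F x)).
- by move=> x; exact: cvgD (continuous_comb WF1 (x:=x)) (continuous_comb WF2 (x:=x)).
- exact: continuous_comb.
- by move=> t x; rewrite !sqZ// mulrDr.
- by move=> t x; rewrite sqZ.
- move=> x x0; rewrite lt_neqAle a_ge0 ?andbT; last exact: Wcomb.
  apply: contra x0; rewrite eq_sym => /eqP/a_eq0 => /(_ (Wcomb _ _ x WF)).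
  rewrite combE => /subr0_eq; rewrite comb1 comb2 => /indep[c0 d0].
  apply/eqP/rowP => k; rewrite mxE -(enum_valK k).
  by case: (enum_val k) => i; [exact: c0|exact: d0].
exists e => // c d /=.
pose x : 'rV[R]_#|{: I1 + I2}| :=
  \row_k match enum_val k with inl i => c i | inr j => d j end.
have := He x; rewrite combE comb1 comb2.
rewrite (eq_bigr (fun i => c i *: f1 i)); last by move=> i _; rewrite mxE enum_rankK.
by rewrite (eq_bigr (fun i => d i *: f2 i))// => i _; rewrite mxE enum_rankK.
Qed.

Definition span_of (I : finType) (f : I -> V) : set V :=
  [set v | exists c : I -> R, v = \sum_i c i *: f i].

Local Notation nrm u := (Num.sqrt (a u u)).
Definition cosines : set R := [set r | exists u1 u2,
  [/\ span_of f1 u1, u1 != 0, span_of f2 u2, u2 != 0 & r = a u1 u2 / (nrm u1 * nrm u2)]].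

Let span1 u : span_of f1 u -> W u. Proof. by move=> [c ->]; exact: subspace_sum. Qed.
Let span2 u : span_of f2 u -> W u. Proof. by move=> [c ->]; exact: subspace_sum. Qed.

Let nrm_gt0 u : W u -> u != 0 -> 0 < nrm u.
Proof.
move=> Wu u0; rewrite sqrtr_gt0 lt_neqAle a_ge0// andbT eq_sym.
by apply: contra u0 => /eqP/a_eq0 => /(_ Wu) ->.
Qed.

Let nrm_unit u : W u -> u != 0 -> a ((nrm u)^-1 *: u) ((nrm u)^-1 *: u) = 1.
Proof.
move=> Wu u0; have N0 := nrm_gt0 Wu u0; have Wv := subspaceZ subW (nrm u)^-1 Wu.
rewrite (sformZl forma)// (sformZr forma)// -[X in _ * (_ * X)]sqr_sqrtr ?a_ge0//.
by rewrite expr2 mulKf ?mulVf ?gt_eqF.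
Qed.

Let span_ofZ (I : finType) (f : I -> V) t u : span_of f u -> span_of f (t *: u).
Proof.
move=> [c ->]; exists (fun i => t * c i).
by rewrite scaler_sumr; apply: eq_bigr => i _; rewrite scalerA.
Qed.

(** For unit vectors, [angle_gap] reads [2 * e <= 2 - 2 * a v1 v2]. *)
Lemma cosines_ubound : exists2 g, g < 1 & ubound cosines g.
Proof.
have [e e0 He] := angle_gap; exists (1 - e); first by rewrite gtrBl.
move=> _ [u1 [u2 [s1 n1 s2 n2 ->]]].
have W1 := span1 s1; have W2 := span2 s2.
have N1 := nrm_gt0 W1 n1; have N2 := nrm_gt0 W2 n2.
pose v1 := (nrm u1)^-1 *: u1; pose v2 := (nrm u2)^-1 *: u2.
have Wv1 : W v1 by exact: subspaceZ.
have Wv2 : W v2 by exact: subspaceZ.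
have a1 : a v1 v1 = 1 by exact: nrm_unit.
have a2 : a v2 v2 = 1 by exact: nrm_unit.
have a12 : a v1 v2 = a u1 u2 / (nrm u1 * nrm u2).
  by rewrite (sformZl forma)// (sformZr forma)// mulrA -invfM mulrC.
have [[c vc] [d vd]] := (span_ofZ (nrm u1)^-1 s1, span_ofZ (nrm u2)^-1 s2).
have := He c d; rewrite /= -vc -vd -/v1 -/v2.
have Wv12 : W (v1 - v2) by exact: subspaceB.
rewrite (sformBl subW forma)// !(sformBr subW forma)// (sformC forma v2 v1).
by rewrite a1 a2 a12; lra.
Qed.

Lemma sup_cosines_lt1 : sup cosines < 1.
Proof.
have [g g1 ubg] := cosines_ubound.
have [ne|/set0P/negP/negPn/eqP ->] := pselect (cosines !=set0); last by rewrite sup0.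
by apply: le_lt_trans g1; exact: ge_sup.
Qed.

Let cosine_le_sup r : cosines r -> r <= sup cosines.
Proof.
move=> cr; have [g _ ubg] := cosines_ubound.
by apply: ub_le_sup => //; exists g.
Qed.

Let cosinesN r : cosines r -> cosines (- r).
Proof.
move=> [u1 [u2 [s1 n1 s2 n2 ->]]]; exists (-1 *: u1), u2; split => //.
- exact: span_ofZ.
- by rewrite scaleN1r oppr_eq0.
have W1 := span1 s1; have W2 := span2 s2; have WZ := subspaceZ subW (-1) W1.
by rewrite !(sformZl forma)// (sformZr forma)// mulrA mulrNN !mul1r mulN1r mulNr.
Qed.

(** The set of cosines is stable under negation; when it is empty its supremum
    is 0. *)
Lemma sup_cosines_ge0 : 0 <= sup cosines.
Proof.
have [[r cr]|/set0P/negP/negPn/eqP ->] := pselect (cosines !=set0); last by rewrite sup0.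
have := cosine_le_sup cr; have := cosine_le_sup (cosinesN cr); lra.
Qed.

Lemma cosine_lower_bound u1 u2 : span_of f1 u1 -> span_of f2 u2 ->
  - (sup cosines / 2 * (a u1 u1 + a u2 u2)) <= a u1 u2.
Proof.
move=> s1 s2; have W1 := span1 s1; have W2 := span2 s2; have g0 := sup_cosines_ge0.
have rhs0 : - (sup cosines / 2 * (a u1 u1 + a u2 u2)) <= 0.
  by rewrite oppr_le0 !mulr_ge0// ?addr_ge0 ?a_ge0.
have a0 u : W u -> a 0 u = 0.
  by move=> Wu; rewrite -(scale0r u) (sformZl forma)// mul0r.
have [u10|n1] := eqVneq u1 0; first by rewrite [leRHS](_ : _ = 0)// u10 a0.
have [u20|n2] := eqVneq u2 0; first by rewrite [leRHS](_ : _ = 0)// u20 (sformC forma) a0.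
have N1 := nrm_gt0 W1 n1; have N2 := nrm_gt0 W2 n2.
have /cosine_le_sup : cosines (- (a u1 u2 / (nrm u1 * nrm u2))).
  by apply: cosinesN; exists u1, u2.
rewrite -mulNr ler_pdivrMr ?mulr_gt0// => H.
rewrite lerNl (le_trans H)// -mulrA ler_wpM2l//.
have e1 : a u1 u1 = nrm u1 ^+ 2 by rewrite sqr_sqrtr ?a_ge0.
have e2 : a u2 u2 = nrm u2 ^+ 2 by rewrite sqr_sqrtr ?a_ge0.
have := sqr_ge0 (nrm u1 - nrm u2); move: e1 e2.
by move: (nrm u1) (nrm u2) => x y -> ->; rewrite sqrrB => ?; lra.
Qed.

End angle.

(** * Finite element and multiscale spaces *)

Section function_spaces.
Variables (R : realType) (d : nat) (T : mesh R d).
Local Notation E := 'rV[R]_d.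
Local Notation D := (dom T).
Local Notation ibox k := (open_box (@lo R d T k) (hi k)).

Lemma tame_subspace : subspace_pred (tame T : set (E -> R)).
Proof.
by split; [exact: tame_cst|move=> u v; exact: tameD|move=> c u; exact: tameZ].
Qed.

Lemma inner_form : symmetric_form_on (tame T : set (E -> R)) (inner T).
Proof.
by split; [exact: innerC|move=> *; exact: innerDl|move=> *; exact: innerZl].
Qed.

Lemma fe_space_cellwise u : fe_space T u -> cellwise_multilinear T u.
Proof. by case. Qed.

Lemma fe_space_tame u : fe_space T u -> tame T u.
Proof. by move=> /fe_space_cellwise; exact: tame_cellwise_multilinear. Qed.

Lemma fe_space_subspace : subspace_pred (fe_space T).
Proof.
split.
- split => //; first by apply: continuous_subspaceT; exact: cst_continuous.
  move=> k; exists (fun=> 0) => x _.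
  by rewrite big1// => S _; rewrite mul0r.
- move=> u v [cu Hu u0] [cv Hv v0]; split.
  + by move=> x; exact: cvgD (cu x) (cv x).
  + exact: cellwise_multilinearD.
  + by move=> x nx; transitivity ((u x : R) + v x) => //; rewrite u0// v0// addr0.
- move=> c u [cu Hu u0]; split.
  + by move=> x; exact: cvgZr (cu x).
  + exact: cellwise_multilinearZ.
  + by move=> x nx; transitivity (c * (u x : R)) => //; rewrite u0// mulr0.
Qed.

Lemma coarse_closure_off_faces (i : 'I_(ncoarse T)) x : coarse_closure i x -> ~ face_planes T x ->
  exists2 k, parent k = i & ibox k x.
Proof. by move=> [k /= ki xk] nf; exists k => //; exact: cell_off_faces. Qed.

(** Coarse elements meet only in faces of fine cells. *)
Lemma coarse_closure_inj (i j : 'I_(ncoarse T)) x : coarse_closure i x -> coarse_closure j x ->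
  ~ face_planes T x -> i = j.
Proof.
move=> xi xj nf; have [k <- xk] := coarse_closure_off_faces xi nf.
by have [l <- xl] := coarse_closure_off_faces xj nf; rewrite (open_box_inj xk xl).
Qed.

Lemma fe_local_tame (i : 'I_(ncoarse T)) u : fe_local i u -> tame T u.
Proof.
move=> [_ Hu u0]; apply: tame_cellwise => k.
have [ki|ki] := eqVneq (parent k) i.
  have [c Hc] := Hu k ki.
  apply: (tame_ae _ (tame_mlin k c)) => x _ _.
  rewrite indicE; case: (boolP (_ \in _)) => [|_]; last by rewrite !mul0r.
  by rewrite inE => xk; rewrite Hc//; exact: open_box_cell.
apply: (tame_ae _ (tame_cst T 0)) => x _ nf.
rewrite indicE; case: (boolP (_ \in _)) => [|_]; last by rewrite mul0r.
rewrite inE => xk; rewrite u0 ?mulr0// => xi.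
have [l li xl] := coarse_closure_off_faces xi nf.
by move: ki; rewrite (open_box_inj xk xl) li eqxx.
Qed.

Lemma measurable_coarse i : measurable (@coarse R d T i).
Proof.
apply: measurableI; first exact: measurable_dom.
apply: fin_bigcup_measurable => // k _.
rewrite (_ : cell k = [set x : E | forall j, `[@lo R d T k 0 j, hi k 0 j]%classic (x 0 j)]).
  apply: (@measurable_rV_box _ _ (fun j => `[lo k 0 j, hi k 0 j]%classic)) => j.
  exact: measurable_itv.
by apply/seteqP; split => x H j; have := H j; rewrite /= in_itv.
Qed.

Lemma integ0 f : (forall x, D x -> ~ face_planes T x -> f x = 0) -> integ T f = 0.
Proof.
move=> f0; rewrite (@integ_off_faces _ _ _ f (fun x => 0 * (cst 0) x)).
  by rewrite integZ ?mul0r//; exact: tame_cst.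
by move=> x Dx nf; rewrite mul0r f0.
Qed.

End function_spaces.

Section multiscale_spaces.
Variables (R : realType) (d : nat) (T : mesh R d).
Local Notation E := 'rV[R]_d.
Local Notation mu := (@lebesgue_rV R d).
Local Notation D := (dom T).
Variables (kappa : E -> R) (kappa0 kappa1 kcut : R).
Hypothesis mkappa : measurable_fun D kappa.
Hypothesis kappa0_gt0 : 0 < kappa0.
Hypothesis kappa_bound : forall x, D x -> kappa0 <= kappa x <= kappa1.

Local Notation a := (energy T kappa).
Local Notation psi := (@psi R d T kappa kcut).
Local Notation region := (@region R d T kappa kcut).

Lemma energy_form : symmetric_form_on (fe_space T) a.
Proof.
split; first exact: energyC.
  by move=> u v w *; apply: (energyDl mkappa kappa0_gt0 kappa_bound);
    exact: fe_space_cellwise.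
by move=> c u w *; apply: (energyZl mkappa kappa0_gt0 kappa_bound);
  exact: fe_space_cellwise.
Qed.

Lemma measurable_region i h : measurable (region i h).
Proof.
rewrite (_ : region i h = coarse i `&`
    (D `&` kappa @^-1` (if h then `]kcut, +oo[ else `]-oo, kcut])%classic)).
  apply: measurableI; first exact: measurable_coarse.
  by apply: mkappa; [exact: measurable_dom|case: h; exact: measurable_itv].
have condE x : (if h then kcut < kappa x else kappa x <= kcut) =
    (kappa x \in (if h then `]kcut, +oo[ else `]-oo, kcut])).
  by case: (h); rewrite in_itv/= ?andbT.
apply/seteqP; split => x; rewrite /region /= condE.
  by move=> [[Dx xi] kx]; do 2!split => //; case: (h) kx.
by move=> [xi [_ kx]]; split => //; case: (h) kx.
Qed.

Lemma psi_tame p : tame T (psi p).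
Proof.
by apply: tameM; [apply: tame_indic; exact: measurable_region|exact: tame_cst].
Qed.

(** Distinct regions are disjoint up to a null set, and the normalisation is the
    square root of the measure of the region. *)
Lemma inner_psi p q : inner T (psi p) (psi q) = (p == q)%:R.
Proof.
rewrite innerE; case: (eqVneq p q) => [<-|pq] /=; last first.
  apply: integ0 => x Dx nf; rewrite /psi !indicE.
  case: (boolP (_ \in _)) => [|_]; last by rewrite !mul0r.
  rewrite inE => -[[_ xp] hp]; case: (boolP (_ \in _)) => [|_]; last by rewrite !mul0r mulr0.
  rewrite inE => -[[_ xq] hq]; exfalso; move/eqP: pq; apply; apply: val_inj.
  have := coarse_closure_inj xp xq nf; move: hp hq.
  case: (val p) (val q) => [i h] [j h'] /= hp hq ->; congr pair.
  by case: h hp; case: h' hq => // H1 H2; lra.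
set A := region (val p).1 (val p).2.
have mA : measurable A by exact: measurable_region.
have AD : A `<=` D by move=> x [[]].
have Agt0 : (0 < mu A)%E := valP p.
have Alt : (mu A < +oo)%E.
  apply: le_lt_trans (lebesgue_dom_lty T); apply: le_measure; rewrite ?inE//.
  exact: measurable_dom.
have fA : 0 < fine (mu A) by rewrite fine_gt0// Agt0.
rewrite (@integ_off_faces _ _ _ _ (fun x => (fine (mu A))^-1 * \1_A x)).
  by rewrite integZ; [rewrite integ_indic// setIidl// mulVf// gt_eqF|exact: tame_indic].
move=> x _ _; rewrite /psi -/A indicE; case: (_ \in _); rewrite /= ?mul0r ?mulr0//.
by rewrite mulr1 mul1r -invfM -expr2 sqr_sqrtr// ltW.
Qed.

Variables (dimV : 'I_(ncoarse T) -> nat) (xi : 'I_(ncoarse T) -> nat -> E -> R).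
Variables (gamma : 'I_(ncoarse T) -> nat -> R) (L : 'I_(ncoarse T) -> nat).
Hypothesis eigenbasis :
  forall i, local_eigenbasis kappa kcut i (dimV i) (xi i) (gamma i).
Hypothesis L_le : forall i, (L i <= dimV i)%N.

Local Notation kept := (@kept R d T L xi).

Lemma kept_local q : fe_local (tag q) (kept q) /\ Vtilde T kappa kcut (kept q).
Proof.
have [Vxi _ _ _ _] := eigenbasis (tag q).
by apply: Vxi; exact: leq_trans (ltn_ord _) (L_le _).
Qed.

Lemma kept_tame q : tame T (kept q).
Proof. by have [/fe_local_tame] := kept_local q. Qed.

(** Eigenfunctions of the same element are orthonormal by construction, and
    those of different elements have disjoint supports up to a null set. *)
Lemma inner_kept q r : inner T (kept q) (kept r) = (q == r)%:R.
Proof.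
have [[_ _ q0] _] := kept_local q; have [[_ _ r0] _] := kept_local r.
case: q q0 => i j q0; case: r r0 => i' j' r0.
have [ii'|ne] := eqVneq i i'.
  subst i'; have [_ _ ortho _ _] := eigenbasis i.
  rewrite /kept /= ortho ?(leq_trans (ltn_ord _) (L_le _))//.
  by rewrite -tag_eqE /tag_eq /= eqxx tagged_asE.
rewrite -tag_eqE /tag_eq /= (negbTE ne) /= innerE; apply: integ0 => x Dx nf.
have [xi_|nx] := pselect (coarse_closure i x); last by rewrite q0 ?mul0r.
rewrite r0 ?mulr0//= => xi'.
by move: ne; rewrite (coarse_closure_inj xi_ xi' nf) eqxx.
Qed.

Lemma inner_kept_psi q p : inner T (kept q) (psi p) = 0.
Proof. by have [_] := kept_local q; apply. Qed.

Local Notation b := (lumped kappa kcut L xi).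
Local Notation pi_aux := (pi_aux kappa kcut L xi).

Lemma proj_tame (I : finType) (f : I -> E -> R) v : (forall i, tame T (f i)) ->
  tame T (Defs.proj T f v).
Proof. by move=> tf; apply: (subspace_sum (tame_subspace T)). Qed.

Lemma projD (I : finType) (f : I -> E -> R) u v : (forall i, tame T (f i)) ->
  tame T u -> tame T v -> Defs.proj T f (u + v) = Defs.proj T f u + Defs.proj T f v.
Proof.
move=> tf tu tv; rewrite /Defs.proj -big_split; apply: eq_bigr => i _.
by rewrite innerDl// scalerDl.
Qed.

Lemma projZ (I : finType) (f : I -> E -> R) c v : (forall i, tame T (f i)) ->
  tame T v -> Defs.proj T f (c *: v) = c *: Defs.proj T f v.
Proof.
move=> tf tv; rewrite /Defs.proj scaler_sumr; apply: eq_bigr => i _.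
by rewrite innerZl// scalerA.
Qed.

Lemma pi_aux_tame v : tame T (pi_aux v).
Proof.
by apply: tameD; apply: proj_tame => i; [exact: psi_tame|exact: kept_tame].
Qed.

Lemma pi_auxD u v : tame T u -> tame T v -> pi_aux (u + v) = pi_aux u + pi_aux v.
Proof.
move=> tu tv; rewrite [LHS]/Defs.pi_aux (projD psi_tame tu tv) (projD kept_tame tu tv).
by rewrite addrACA.
Qed.

Lemma pi_auxZ c v : tame T v -> pi_aux (c *: v) = c *: pi_aux v.
Proof.
move=> tv; rewrite [LHS]/Defs.pi_aux (projZ _ psi_tame tv) (projZ _ kept_tame tv).
by rewrite -scalerDr.
Qed.

Lemma lumped_form : symmetric_form_on (fe_space T) b.
Proof.
split => [u v|u v w fu fv fw|c u w fu fw]; first exact: innerC.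
  rewrite [LHS]/lumped pi_auxD; [|exact: fe_space_tame..].
  by apply: innerDl; exact: pi_aux_tame.
rewrite [LHS]/lumped pi_auxZ; last exact: fe_space_tame.
by apply: innerZl; exact: pi_aux_tame.
Qed.

Lemma lumped_ge0 v : 0 <= b v v.
Proof. exact: inner_ge0. Qed.

Lemma fspan_mem (I : finType) (f : I -> E -> R) i : fspan f (f i).
Proof.
exists (fun j => (j == i)%:R); rewrite (bigD1 i)//= eqxx scale1r big1 ?addr0//.
by move=> j /negbTE ->; rewrite scale0r.
Qed.

Variables (m : nat) (phi1 mu1 : aux1_index T kappa kcut -> E -> R).
Variables (phi2 mu2 : aux2_index L -> E -> R).
Hypothesis basis_phi1 : forall p, basis1 L xi m p (phi1 p) (mu1 p).
Hypothesis basis_phi2 : forall q, basis2 kappa kcut xi m q (phi2 q) (mu2 q).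

Lemma phi1_fe p : fe_space T (phi1 p).
Proof. by have [[]] := basis_phi1 p. Qed.

Lemma phi2_fe q : fe_space T (phi2 q).
Proof. by have [[]] := basis_phi2 q. Qed.

(** The constraints that define the multiscale basis functions say that they
    are dual to the auxiliary functions. So pairing a combination of basis
    functions with [psi] and [kept] reads off its coefficients. *)
Lemma inner_phi1_psi p p' : inner T (phi1 p) (psi p') = (p == p')%:R.
Proof.
have [_ _ _ /(_ _ (fspan_mem _ p')) + _] := basis_phi1 p.
rewrite (sformBl (tame_subspace T) (inner_form T)) ?inner_psi; first by move/subr0_eq.
all: by [exact: psi_tame|apply: fe_space_tame; exact: phi1_fe].
Qed.

Lemma inner_phi1_kept p q : inner T (phi1 p) (kept q) = 0.
Proof. by have [_ _ _ _ /(_ _ (fspan_mem _ q))] := basis_phi1 p. Qed.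

Lemma inner_phi2_psi q p : inner T (phi2 q) (psi p) = 0.
Proof. by have [_ _ _ /(_ _ (fspan_mem _ p)) + _] := basis_phi2 q. Qed.

Lemma inner_phi2_kept q q' : inner T (phi2 q) (kept q') = (q == q')%:R.
Proof.
have [_ _ _ _ /(_ _ (fspan_mem _ q'))] := basis_phi2 q.
rewrite (sformBl (tame_subspace T) (inner_form T)) ?inner_kept; first by move/subr0_eq.
all: by [exact: kept_tame|apply: fe_space_tame; exact: phi2_fe].
Qed.

Lemma inner_comb_dual (I : finType) (f : I -> E -> R) c w i :
  (forall j, tame T (f j)) -> tame T w -> (forall j, inner T (f j) w = (j == i)%:R) ->
  inner T (\sum_j c j *: f j) w = c i.
Proof.
move=> tf tw fw; rewrite (sform_suml (tame_subspace T) (inner_form T))//.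
rewrite (bigD1 i)//= fw eqxx mulr1 big1 ?addr0// => j /negbTE ji.
by rewrite fw ji mulr0.
Qed.

Lemma inner_comb0 (I : finType) (f : I -> E -> R) c w :
  (forall j, tame T (f j)) -> tame T w -> (forall j, inner T (f j) w = 0) ->
  inner T (\sum_j c j *: f j) w = 0.
Proof.
move=> tf tw fw; rewrite (sform_suml (tame_subspace T) (inner_form T))//.
by rewrite big1// => j _; rewrite fw mulr0.
Qed.

Let phi1_tame p := fe_space_tame (phi1_fe p).
Let phi2_tame q := fe_space_tame (phi2_fe q).

(** A common value of the two combinations is orthogonal to all [kept] as a
    combination of [phi1], and to all [psi] as a combination of [phi2]. *)
Lemma multiscale_independent c e :
  \sum_p c p *: phi1 p = \sum_q e q *: phi2 q ->
  (forall p, c p = 0) /\ (forall q, e q = 0).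
Proof.
move=> ce; split => [p|q].
  rewrite -(inner_comb_dual c phi1_tame (psi_tame p) (inner_phi1_psi^~ p)) ce.
  exact: inner_comb0 phi2_tame (psi_tame p) (inner_phi2_psi^~ p).
rewrite -(inner_comb_dual e phi2_tame (kept_tame q) (inner_phi2_kept^~ q)) -ce.
exact: inner_comb0 phi1_tame (kept_tame q) (inner_phi1_kept^~ q).
Qed.

Lemma pi_aux_comb1 c : pi_aux (\sum_p c p *: phi1 p) = \sum_p c p *: psi p.
Proof.
rewrite /pi_aux /Defs.proj [X in _ + X]big1 ?addr0.
  apply: eq_bigr => p _.
  by rewrite (inner_comb_dual c phi1_tame (psi_tame p) (inner_phi1_psi^~ p)).
move=> q _.
by rewrite (inner_comb0 c phi1_tame (kept_tame q) (inner_phi1_kept^~ q)) scale0r.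
Qed.

Lemma pi_aux_comb2 e : pi_aux (\sum_q e q *: phi2 q) = \sum_q e q *: kept q.
Proof.
rewrite /pi_aux /Defs.proj [X in X + _]big1 ?add0r.
  apply: eq_bigr => q _.
  by rewrite (inner_comb_dual e phi2_tame (kept_tame q) (inner_phi2_kept^~ q)).
move=> p _.
by rewrite (inner_comb0 e phi2_tame (psi_tame p) (inner_phi2_psi^~ p)) scale0r.
Qed.

(** The projection maps combinations of [phi1] to combinations of [psi], and
    those of [phi2] to combinations of [kept]; the eigenfunctions are orthogonal
    to the characteristic functions. *)
Lemma lumped_orthogonal v1 v2 : fspan phi1 v1 -> fspan phi2 v2 -> b v1 v2 = 0.
Proof.
move=> [c ->] [e ->]; rewrite /lumped pi_aux_comb1 pi_aux_comb2 innerC.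
apply: inner_comb0; first exact: kept_tame.
  by apply: (subspace_sum (tame_subspace T)) => p; exact: psi_tame.
move=> q; rewrite innerC; apply: inner_comb0; [exact: psi_tame|exact: kept_tame|].
by move=> p; rewrite innerC inner_kept_psi.
Qed.

End multiscale_spaces.

(** * Stability *)

Lemma fspanB (R : realType) (d : nat) (I : finType) (f : I -> 'rV[R]_d -> R) u v :
  fspan f u -> fspan f v -> fspan f (u - v).
Proof.
move=> [c ->] [c' ->]; exists (fun i => c i - c' i).
by rewrite -sumrB; apply: eq_bigr => i _; rewrite scalerBl.
Qed.

Lemma le_div_of_mul_le (R : realFieldType) (t g s e : R) : 0 < t -> g < 1 ->
  t / 2 * (1 - g) * s <= e -> s <= 2 / (t * (1 - g)) * e.
Proof.
move=> t0 g1 low; have tg : 0 < t * (1 - g) by rewrite mulr_gt0// subr_gt0.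
by rewrite mulrAC ler_pdivlMr//; lra.
Qed.

Section stability.
Variables (R : realType) (V : lmodType R) (W : set V) (a b : V -> V -> R).
Hypotheses (subW : subspace_pred W).
Hypotheses (forma : symmetric_form_on W a) (formb : symmetric_form_on W b).

(** Since [b] has no cross term, the part of [b] that belongs to the second
    component absorbs the negative term of the energy. The two mixed terms of [a]
    cost at most a fraction [g] of the squares. *)
Lemma scheme_energy_lower_bound (tau g : R) (x y X Y : V) : 0 < tau ->
  W x -> W y -> W X -> W Y ->
  0 <= b (x - y) (x - y) -> b (x - y) (X - Y) = 0 ->
  tau ^+ 2 / 2 * a (X - Y) (X - Y) <= b (X - Y) (X - Y) ->
  - (g / 2 * (a y y + a X X)) <= a y X ->
  - (g / 2 * (a x x + a Y Y)) <= a x Y ->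
  tau ^+ 2 / 2 * (1 - g) * (a y y + a X X + a Y Y + a x x)
    <= scheme_energy a b tau x y X Y.
Proof.
move=> tau0 Wx Wy WX WY b1 b12 b2 ayX axY.
have Wd : W (x - y) by exact: subspaceB.
have WD : W (X - Y) by exact: subspaceB.
have WdD : W (x - y + (X - Y)) by exact: subspaceD.
rewrite /scheme_energy.
have -> : x + X - (y + Y) = (x - y) + (X - Y) by rewrite opprD addrACA.
rewrite (sformDl formb Wd WD WdD) (sformDr formb Wd WD Wd) (sformDr formb Wd WD WD).
rewrite (sformC formb (X - Y) (x - y)) b12.
rewrite (sformC forma X y).
have t0 : 0 < tau ^+ 2 by rewrite exprn_gt0.
have h1 : 0 <= tau ^+ 2 * (a y X + g / 2 * (a y y + a X X)).
  by apply: mulr_ge0; [exact: ltW|lra].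
have h2 : 0 <= tau ^+ 2 * (a x Y + g / 2 * (a x x + a Y Y)).
  by apply: mulr_ge0; [exact: ltW|lra].
lra.
Qed.

End stability.

Theorem theorem1 (R : realType) (d : nat) (T : mesh R d)
    (kappa : 'rV[R]_d -> R) (kappa0 kappa1 kcut : R)
    (dimV : 'I_(ncoarse T) -> nat)
    (xi : 'I_(ncoarse T) -> nat -> 'rV[R]_d -> R)
    (gamma : 'I_(ncoarse T) -> nat -> R)
    (L : 'I_(ncoarse T) -> nat) (m : nat)
    (phi1 mu1 : aux1_index T kappa kcut -> 'rV[R]_d -> R)
    (phi2 mu2 : aux2_index L -> 'rV[R]_d -> R)
    (tau : R) (NT : nat) (u1 u2 : nat -> 'rV[R]_d -> R) :
  let a := energy T kappa in
  let normA := norm_a T kappa in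
  let b := lumped kappa kcut L xi in
  let normB := norm_b kappa kcut L xi in
  let VH1 := fspan phi1 in
  let VH2 := fspan phi2 in
  let uH n := u1 n + u2 n in
  let E := discrete_energy kappa kcut L xi tau u1 u2 in
  (0 < d)%N ->
  measurable_fun (dom T) kappa ->
  0 < kappa0 ->
  (forall x, dom T x -> kappa0 <= kappa x <= kappa1) ->
  (forall i, local_eigenbasis kappa kcut i (dimV i) (xi i) (gamma i)) ->
  (forall i, (L i <= dimV i)%N) ->
  (0 < m)%N ->
  (forall p, basis1 L xi m p (phi1 p) (mu1 p)) ->
  (forall q, basis2 kappa kcut xi m q (phi2 q) (mu2 q)) ->
  0 < tau ->
  (forall n, (n <= NT)%N -> VH1 (u1 n)) ->
  (forall n, (n <= NT)%N -> VH2 (u2 n)) ->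
  (forall n, (0 < n < NT)%N -> forall w, VH1 w ->
     b (uH n.+1 - 2 *: uH n + uH n.-1) w
     + tau ^+ 2 / 2 * a (u1 n.+1 + u1 n.-1 + 2 *: u2 n) w = 0) ->
  (forall n, (0 < n < NT)%N -> forall w, VH2 w ->
     b (uH n.+1 - 2 *: uH n + uH n.-1) w
     + tau ^+ 2 * a (u1 n + u2 n) w = 0) ->
  (forall v2, VH2 v2 -> normB v2 ^+ 2 >= tau ^+ 2 / 2 * normA v2 ^+ 2) ->
  gamma_a T kappa VH1 VH2 < 1 /\
  (forall n, (0 < n < NT)%N ->
     normA (u1 n) ^+ 2 + normA (u2 n.+1) ^+ 2
     + normA (u2 n) ^+ 2 + normA (u1 n.+1) ^+ 2
     <= 2 / (tau ^+ 2 * (1 - gamma_a T kappa VH1 VH2)) * E 0%N).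
Proof.
move=> a normA b normB VH1 VH2 uH EE d0 mkappa k0 kb eig Lle _ B1 B2 tau0 s1 s2 sch1 sch2 cfl.
have subW := fe_space_subspace T.
have forma := energy_form mkappa k0 kb.
have formb := lumped_form mkappa eig Lle.
have f1 := phi1_fe B1; have f2 := phi2_fe B2.
have a_ge0 u : fe_space T u -> 0 <= a u u by move=> _; exact: energy_ge0 k0 kb u.
have a_eq0 u : fe_space T u -> a u u = 0 -> u = 0 := energy_eq0 mkappa k0 kb d0.
have indep := multiscale_independent mkappa eig Lle B1 B2.
have gE : gamma_a T kappa VH1 VH2 = sup (cosines a phi1 phi2) by [].
have W1 u : VH1 u -> fe_space T u by move=> [c ->]; exact: subspace_sum.
have W2 u : VH2 u -> fe_space T u by move=> [c ->]; exact: subspace_sum.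
have nA u : normA u ^+ 2 = a u u by rewrite sqr_sqrtr//; exact: energy_ge0 k0 kb u.
have nB u : normB u ^+ 2 = b u u by rewrite sqr_sqrtr//; exact: lumped_ge0.
have g1 : gamma_a T kappa VH1 VH2 < 1.
  by rewrite gE; exact: (sup_cosines_lt1 subW forma a_ge0 a_eq0 f1 f2 indep).
have lower u v : VH1 u -> VH2 v ->
    - (gamma_a T kappa VH1 VH2 / 2 * (a u u + a v v)) <= a u v.
  exact: (cosine_lower_bound subW forma a_ge0 a_eq0 f1 f2 indep).
split => // n /andP[n0 nNT].
have EEE k : EE k = scheme_energy a b tau (u1 k.+1) (u1 k) (u2 k.+1) (u2 k).
  rewrite /scheme_energy -!nA -nB.
  reflexivity.
clearbody EE normA normB.
have conserved k : (k < NT)%N -> EE k = EE 0%N.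
  elim: k => // k IH kNT; rewrite -IH ?(ltnW kNT)// !EEE.
  have kNT1 := ltnW kNT; have kNT0 := ltnW kNT1.
  apply: (scheme_energy_conserved subW forma formb).
  1-3: by apply: W1; exact: s1.
  1-3: by apply: W2; exact: s2.
  (* centred differences as test functions *)
  - by apply: (sch1 k.+1 kNT); apply: fspanB; exact: s1.
  - by apply: (sch2 k.+1 kNT); apply: fspanB; exact: s2.
have nNT' := ltnW nNT.
have x1 := s1 _ nNT; have y1 := s1 _ nNT'; have x2 := s2 _ nNT; have y2 := s2 _ nNT'.
have dx := fspanB x1 y1; have dX := fspanB x2 y2.
rewrite -(conserved n)// EEE !nA.
have cfl' : tau ^+ 2 / 2 * a (u2 n.+1 - u2 n) (u2 n.+1 - u2 n)
    <= b (u2 n.+1 - u2 n) (u2 n.+1 - u2 n) by rewrite -nA -nB; exact: cfl.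
have low := scheme_energy_lower_bound subW forma formb tau0 (W1 _ x1) (W1 _ y1)
  (W2 _ x2) (W2 _ y2) (lumped_ge0 _ _ _ _ _)
  (lumped_orthogonal mkappa eig Lle B1 B2 dx dX) cfl' (lower _ _ y1 x2) (lower _ _ x1 y2).
exact: (le_div_of_mul_le (exprn_gt0 2 tau0) g1 low).
Qed.
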